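(* Let $n\ge 1$, let $\mathcal{A}=(a_1,\dots,a_n)$ and $\mathcal{B}=(b_1,\dots,b_n)$ be sequences of nonnegative integers, and let $sgn,\overline{sgn}:\{1,\dots,n\}\to\{1,-1\}$ be two sign functions. Put $\overline{A}_j=\sum_{i=1}^{j}\overline{sgn}(i)a_i$. Then $$\prod_{i=1}^n [z+sgn(i)b_i]_{a q^{-2\,sgn(i)b_i},\,b q^{-sgn(i)b_i};q,p} =\sum_{k=0}^n R_{n-k}^{\mathcal{A}}(a,b;q,p;\mathcal{B}^{\mathcal{A}},sgn,\overline{sgn})\prod_{j=1}^{k}[z+\overline{A}_j]_{a q^{-2\overline{A}_j},\,b q^{-\overline{A}_j};q,p}.$$
   Context: Parameters $a,b,q,p$ are nonzero complex numbers with $|p|<1$, generic so that all denominators below are nonzero. The modified Jacobi theta function is $\theta(x;p)=\prod_{j\ge0}(1-p^jx)(1-p^{j+1}/x)$ and $\theta(x_1,\dots,x_m;p)=\prod_{k=1}^m\theta(x_k;p)$. For an integer $k$ (positive, zero or negative) the elliptic weight is $$W_{a,b;q,p}(k)=\frac{\theta(aq^{2k+1},bq,bq^2,aq^{-1}/b,a/b;p)}{\theta(aq,bq^{k+1},bq^{k+2},aq^{k-1}/b,aq^k/b;p)}\,q^k$$ (so $W_{a,b;q,p}(0)=1$), and for a number $z$ the elliptic number is $$[z]_{a,b;q,p}=\frac{\theta(q^z,aq^z,bq^2,a/b;p)}{\theta(q,aq,bq^{z+1},aq^{z-1}/b;p)}.$$ Below $W(k)$ means $W_{a,b;q,p}(k)$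 (unshifted parameters). Augmented board: let $A_i=a_1+\cdots+a_i$ ($A_0=0$). The board $\mathcal{B}^{\mathcal{A}}$ consists of the cells $(i,r)$ (column $i$, row $r$ counted from the bottom) with $1\le i\le n$, $1\le r\le b_i+A_i$. In column $i$, rows $1,\dots,b_i$ form the base part, and for $1\le s\le i$ the rows $b_i+A_{s-1}+1,\dots,b_i+A_s$ form the $a_s$-th part of column $i$ (the augmented part). Placements and cancellation: consider placements $P$ of rooks in $\mathcal{B}^{\mathcal{A}}$ with at most one rook per column, processed from left to right. A rook in column $j$ cancels, in every column $i>j$, all cells of the $a_s$-th part of column $i$ where $s$ is the largest index such that the $a_s$-th part of column $i$ has not been cancelled by a rook in a column to the left of $j$. $P$ is nonattacking if no rook lies in a cell cancelled by a rook to its left. $\mathcal{N}_k^{\mathcal{A}}(\mathcal{B}^{\mathcal{A}})$ denotes the set of nonattacking placements of $k$ rooks. Cell weights $M(c)$ on $\mathcal{B}^{\mathcal{A}}$: in column $i$, the base-part cells, read from bottom to top, have weights $-1,-W(1),-W(2),\dots,-W(b_i-1)$ if $sgn(i)=-1$, and $W(-1),W(-2),\dots,W(-b_i)$ if $sgn(i)=1$. The cell at position $t$ ($1\le t\le a_s$), counted from the bottom, of the $a_s$-th part of column $i$ has weight $-W(-\overline{A}_{s-1}-t)$ if $\overline{sgn}(s)=1$, and $W(-\overline{A}_{s-1}+t-1)$ if $\overline{sgn}(s)=-1$ (where $\overline{A}_0=0$). For $P\in\mathcal{N}_k^{\mathcal{A}}(\mathcal{B}^{\mathcal{A}})$ with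 rooks in cells $c_1,\dots,c_k$ let $M(P)=\prod_{i=1}^k M(c_i)$, let $M\!R_k^{\mathcal{A}}(a,b;q,p;\mathcal{B}^{\mathcal{A}},sgn,\overline{sgn})=\sum_{P\in\mathcal{N}_k^{\mathcal{A}}(\mathcal{B}^{\mathcal{A}})}M(P)$ (equal to $1$ for $k=0$), and $$R_{n-k}^{\mathcal{A}}(a,b;q,p;\mathcal{B}^{\mathcal{A}},sgn,\overline{sgn})=\frac{\prod_{s=1}^{k}W(-\overline{A}_s)}{\prod_{i=1}^nW(-sgn(i)b_i)}\,M\!R_{n-k}^{\mathcal{A}}(a,b;q,p;\mathcal{B}^{\mathcal{A}},sgn,\overline{sgn}).$$ *)

(* Defs.v *)
From HB Require Import structures.
From mathcomp Require Import all_boot all_order all_algebra.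
From mathcomp Require Import all_classical all_reals all_analysis.
From mathcomp Require Import complex.

Set Implicit Arguments.
Unset Strict Implicit.
Unset Printing Implicit Defensive.

Import Order.TTheory GRing.Theory Num.Theory.
Import numFieldNormedType.Exports.

Local Open Scope ring_scope.
Local Open Scope complex_scope.

(* [theta] is stated over a [numFieldType] because R[i] receives its topology
   (the one of its norm) through that structure. *)
Definition theta (K : numFieldType) (p x : K) : K :=
  lim ((\prod_(0 <= j < m) ((1 - p ^+ j * x) * (1 - p ^+ j.+1 / x)))
         @[m --> \oo])%classic.

Definition thetas (K : numFieldType) (p : K) (xs : seq K) : K :=
  \prod_(x <- xs) theta p x.

Definition cexp (R : realType) (z : R[i]) : R[i] :=
  (expR (complex.Re z))%:C *
    (cos (complex.Im z) +i* sin (complex.Im z)).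

Section EllipticWeights.
Variable R : realType.
Local Notation C := R[i].
Implicit Types (a b q p l z : C) (k : int).

Definition ell_weight_den a b q p k : C :=
  thetas p [:: a * q; b * q ^ (k + 1); b * q ^ (k + 2);
               a * q ^ (k - 1) / b; a * q ^ k / b].

Definition ell_weight a b q p k : C :=
  thetas p [:: a * q ^ (2 * k + 1); b * q; b * q ^+ 2; a * q^-1 / b; a / b]
  / ell_weight_den a b q p k * q ^ k.

(* In the elliptic number, l is a logarithm of q: it fixes the determination
   q^w := cexp (l * w) of the complex powers of q. *)
Definition ell_num_den a b q l p z : C :=
  thetas p [:: q; a * q; b * cexp (l * (z + 1)); a * cexp (l * (z - 1)) / b].

Definition ell_num a b q l p z : C :=
  thetas p [:: cexp (l * z); a * cexp (l * z); b * q ^+ 2; a / b]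
  / ell_num_den a b q l p z.

End EllipticWeights.

(* Columns, parts and rows are numbered from 0: the column, part or row i of
   the code is the (i+1)-st one of the mathematics. On the other hand the
   partial sums A_j and \bar A_j are indexed by the number j of summands. *)

Definition psumA (n : nat) (av : 'I_n -> nat) (j : nat) : nat :=
  (\sum_(i < n | (i < j)%N) av i)%N.

Definition spsumA (n : nat) (av : 'I_n -> nat) (sgnb : 'I_n -> int) (j : nat)
    : int :=
  \sum_(i < n | (i < j)%N) sgnb i * (av i)%:Z.

Section AugmentedBoard.
Variables (n : nat) (av bv : 'I_n -> nat).

Definition cell := {i : 'I_n & 'I_(bv i + psumA av i.+1)%N}.

Definition col (c : cell) : 'I_n := tag c.
Definition row (c : cell) : nat := tagged c.

Definition in_part (c : cell) (s : 'I_n) : bool :=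
  [&& (s <= col c)%N, (bv (col c) + psumA av s <= row c)%N
    & (row c < bv (col c) + psumA av s.+1)%N].

(* The set of parts of column i cancelled by the rooks of P lying in the first
   m columns. A part with av s = 0 contains no cell, but still can be the part
   that a rook cancels. *)
Fixpoint cancelled (P : {set cell}) (i : 'I_n) (m : nat) : {set 'I_n} :=
  if m is j.+1 then
    let D := cancelled P i j in
    if [exists c in P, col c == j :> nat] && (j < i)%N then
      D :|: [set s : 'I_n | [&& (s <= i)%N, s \notin D
              & [forall t : 'I_n, (t <= i)%N && (t \notin D) ==> (t <= s)%N]]]
    else D
  else finset.set0.

Definition one_per_column (P : {set cell}) : bool :=
  [forall c in P, forall d in P, (col c == col d) ==> (c == d)].

Definition nonattacking (P : {set cell}) : bool :=
  [forall c in P, forall s, in_part c s ==>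
     (s \notin cancelled P (col c) (col c))].

Definition placements (k : nat) : {set {set cell}} :=
  [set P : {set cell} | [&& #|P| == k, one_per_column P & nonattacking P]].

Variables (R : realType) (a b q p : R[i]) (sgn sgnb : 'I_n -> int).
Local Notation W := (ell_weight a b q p).

Definition base_weight (c : cell) : R[i] :=
  if sgn (col c) == 1 then W (- (row c).+1%:Z)
  else if row c == 0%N then -1 else - W (row c)%:Z.

Definition aug_weight (c : cell) (s : 'I_n) : R[i] :=
  let t := (row c - (bv (col c) + psumA av s)).+1 in
  if sgnb s == 1 then - W (- spsumA av sgnb s - t%:Z)
  else W (- spsumA av sgnb s + t%:Z - 1).

(* A cell lies in at most one part, and in none exactly when it is a base
   cell. *)
Definition cell_weight (c : cell) : R[i] :=
  if [pick s | in_part c s] is Some s then aug_weight c s else base_weight c.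

Definition MR (k : nat) : R[i] :=
  \sum_(P in placements k) \prod_(c in P) cell_weight c.

(* [rookR k] is the R_{n-k} of the mathematics. *)
Definition rookR (k : nat) : R[i] :=
  (\prod_(1 <= s < k.+1) W (- spsumA av sgnb s))
  / (\prod_(i < n) W (- (sgn i * (bv i)%:Z))) * MR (n - k).

End AugmentedBoard.

(* Main.v *)
Require Import Defs.
From HB Require Import structures.
From mathcomp Require Import all_boot all_order all_algebra.
From mathcomp Require Import all_classical all_reals all_analysis.
From mathcomp Require Import complex.
From mathcomp Require Import ring lra zify.

Set Implicit Arguments.
Unset Strict Implicit.
Unset Printing Implicit Defensive.

Import Order.TTheory GRing.Theory Num.Theory.
Import numFieldNormedType.Exports.

Local Open Scope ring_scope.
Local Open Scope complex_scope.

(* Addition formula: [z] - [m] = W(m) [z - m]_{a q^(2m), b q^m}.  With X = [z] and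
   e(m) = [m], multiplying by the weights W therefore turns the left-hand side into
   prod_i (X - e(-sgn(i) b_i)) and the j-th factor on the right-hand side into
   X - e(-Abar_j).  The weights of the first k parts and of the base part of column i
   telescope to e(-Abar_k) - e(-sgn(i) b_i), and a column with r rooks to its left has
   exactly its first i - r parts uncancelled, so the identity follows by adding the
   columns one at a time.

   The addition formula is Weierstrass' three-term relation for theta.  By the Jacobi
   triple product, theta(xy) theta(x/y) / x is a constant times
   O(x) V(y) - V(x) O(y), where O(x) = sum_i p^(i^2+i) x^(2i+1) and
   V(x) = sum_j p^(j^2) x^(2j): it is a 2x2 determinant, and the three-term relation is
   the Plücker relation.  The triple product is used in its finite form (the q-binomial
   theorem), and the double series are compared by dominated convergence over Z x Z. *)

(** * Convergence in the complex numbers *)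

Section ComplexLimits.
Variable R : realType.
Local Notation K := (R[i] : numFieldType).
Import Normc.

Lemma normrE_normc (x : K) : `|x| = (normc x)%:C.
Proof. by []. Qed.

Lemma normc_ge0 (x : K) : 0 <= normc x :> R.
Proof. by rewrite -lecR -normrE_normc normr_ge0. Qed.

(** A positive element of [K] is real in the order of the complex numbers, so its real part can
    serve as the tolerance. *)
Lemma cvg_normc (u : nat -> K) (l : K) :
  ((normc (u n - l) : R^o) @[n --> \oo] --> (0 : R^o))%classic ->
  (u n @[n --> \oo] --> l)%classic.
Proof.
move=> h; apply/cvgrPdistC_lt => e e0.
have eR : e = (complex.Re e)%:C by rewrite RRe_real // ger0_real // ltW.
have e0' : 0 < complex.Re e by rewrite -ltcR -eR.
move/cvgr0Pnorm_lt: h => /(_ _ e0'); apply: filterS => n.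
by rewrite normrE_normc eR ltcR ger0_norm // normc_ge0.
Qed.

Lemma normc_cvg (u : nat -> K) (l : K) :
  (u n @[n --> \oo] --> l)%classic ->
  ((normc (u n - l) : R^o) @[n --> \oo] --> (0 : R^o))%classic.
Proof.
move=> h; apply/cvgr0Pnorm_lt => e e0.
have e0' : 0 < (e%:C : K) by rewrite (ltcR 0 e).
move/cvgrPdistC_lt: h => /(_ _ e0'); apply: filterS => n.
by rewrite normrE_normc ltcR ger0_norm // normc_ge0.
Qed.

Lemma cvg_geometric_steps (v : nat -> R^o) (C r : R) : 0 <= r < 1 ->
  (forall n, `|v n.+1 - v n| <= C * r ^+ n) -> cvg (v n @[n --> \oo])%classic.
Proof.
move=> /andP[r0 r1] h.
have Es : v = (fun n => v 0%N + series (fun k => v k.+1 - v k : R^o) n).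
  by apply/funext => n; rewrite /series /= telescope_sumr // addrC subrK.
rewrite Es; apply: is_cvgD; first exact: is_cvg_cst.
apply: normed_cvg; apply: (@series_le_cvg _ _ (geometric C r)) => [n|n|n|].
- exact: normr_ge0.
- exact: (le_trans (normr_ge0 (v n.+1 - v n)) (h n)).
- exact: h.
- by apply: is_cvg_geometric_series; rewrite ger0_norm.
Qed.

(** The real and imaginary parts converge separately, since their steps are no larger than those of
    [u]. *)
Lemma cvg_geometric_stepsC (u : nat -> K) (C r : R) : 0 <= r < 1 ->
  (forall n, normc (u n.+1 - u n) <= C * r ^+ n) ->
  cvg (u n @[n --> \oo])%classic.
Proof.
move=> hr h.
have Re_le (x : K) : `|complex.Re x| <= normc x.
  by rewrite -lecR; exact: normc_ge_Re.
have Im_le (x : K) : `|complex.Im x| <= normc x.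
  rewrite -(sqrtr_sqr (complex.Im x)) /normc; case: x => x y /=.
  by rewrite ler_wsqrtr // lerDr sqr_ge0.
have [l1 h1] : exists l, ((complex.Re (u n) : R^o) @[n --> \oo] --> (l : R^o))%classic.
  apply/cvg_ex; apply: (@cvg_geometric_steps _ C r hr) => n.
  apply: le_trans (h n); apply: le_trans (Re_le _).
  by case: (u n) (u n.+1) => [? ?] [? ?].
have [l2 h2] : exists l, ((complex.Im (u n) : R^o) @[n --> \oo] --> (l : R^o))%classic.
  apply/cvg_ex; apply: (@cvg_geometric_steps _ C r hr) => n.
  apply: le_trans (h n); apply: le_trans (Im_le _).
  by case: (u n) (u n.+1) => [? ?] [? ?].
apply/cvg_ex; exists (l1 +i* l2 : K); apply: cvg_normc.
have h3 : ((`|complex.Re (u n) - l1| + `|complex.Im (u n) - l2| : R^o)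
     @[n --> \oo] --> (0 : R^o))%classic.
  rewrite -[0]addr0; apply: cvgD; apply/norm_cvg0P; apply/subr_cvg0 => /=.
    by under eq_fun do rewrite /=; exact: h1.
  exact: h2.
apply: (squeeze_cvgr _ (cvg_cst 0) h3); near=> n.
rewrite normc_ge0 /=.
case: (u n) => x y /=; move: (x - l1) (y - l2) => s t.
rewrite -[leRHS]ger0_norm ?addr_ge0 // -sqrtr_sqr ler_wsqrtr //.
by rewrite sqrrD !real_normK ?num_real // addrAC lerDl mulrn_wge0 // mulr_ge0.
Unshelve. all: by end_near. Qed.

End ComplexLimits.

(** * Infinite products whose factors tend to 1 geometrically *)

Section InfiniteProducts.
Variable R : realType.
Local Notation K := (R[i] : numFieldType).
Import Normc.

Lemma normc_prod (I : Type) (s : seq I) (f : I -> K) :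
  normc (\prod_(x <- s) f x) = \prod_(x <- s) normc (f x) :> R.
Proof.
elim: s => [|x s IH]; first by rewrite !big_nil normc1.
by rewrite !big_cons normcM IH.
Qed.

Lemma normc_sum_le (I : Type) (s : seq I) (P : pred I) (f : I -> K) :
  normc (\sum_(x <- s | P x) f x) <= \sum_(x <- s | P x) normc (f x) :> R.
Proof.
elim: s => [|x s IH]; first by rewrite !big_nil normc0.
rewrite !big_cons; case: ifP => // _.
by apply: le_trans (le_normcD _ _) _; rewrite lerD2l.
Qed.

Lemma sum_expr_le (r : R) n : 0 <= r < 1 ->
  \sum_(0 <= j < n) r ^+ j <= (1 - r)^-1.
Proof.
move=> /andP[r0 r1]; have h : 0 < 1 - r by rewrite subr_gt0.
rewrite -[leRHS]mul1r ler_pdivlMr // mulrC big_mkord.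
have := subrX1 r n; rewrite -opprB -(opprB 1 r) mulNr => /oppr_inj <-.
by rewrite gerBl exprn_ge0.
Qed.

Lemma prod_geometric_le (C r : R) n : 0 <= r < 1 -> 0 <= C ->
  \prod_(0 <= j < n) (1 + C * r ^+ j) <= expR (C * (1 - r)^-1).
Proof.
move=> hr C0; have r0 : 0 <= r by case/andP: hr.
apply: (@le_trans _ _ (\prod_(0 <= j < n) expR (C * r ^+ j))).
  apply: ler_prod => j _; rewrite expR_ge1Dx andbT.
  by rewrite addr_ge0 // mulr_ge0 ?exprn_ge0.
by rewrite -expR_sum ler_expR -mulr_sumr ler_wpM2l // sum_expr_le.
Qed.

(** Since 1 + t <= exp t, all partial products are bounded by exp(C/(1 - r)); consecutive ones then
    differ by at most that bound times C r^n. *)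
Lemma cvg_prod_geometric (d : nat -> K) (C r : R) : 0 <= r < 1 ->
  (forall n, normc (d n) <= C * r ^+ n) ->
  cvg ((\prod_(0 <= j < n) (1 + d j)) @[n --> \oo])%classic.
Proof.
move=> hr h.
have C0 : 0 <= C by move: (le_trans (normc_ge0 _) (h 0%N)); rewrite mulr1.
apply: (@cvg_geometric_stepsC _ _ (expR (C * (1 - r)^-1) * C) r hr) => n.
rewrite big_nat_recr //= mulrDr mulr1 addrAC subrr add0r normcM -mulrA.
apply: ler_pM => //; [exact: normc_ge0|exact: normc_ge0|].
apply: le_trans (prod_geometric_le n hr C0); rewrite normc_prod.
apply: ler_prod => j _; rewrite normc_ge0 /=.
by apply: le_trans (le_normcD _ _) _; rewrite normc1 lerD2l.
Qed.

Lemma cvg_normc_bounded (u : nat -> K) :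
  cvg (u n @[n --> \oo])%classic -> exists M, forall n, normc (u n) <= M.
Proof.
move=> /cvg_ex[l /normc_cvg] h.
have /cvg_seq_bounded/bounded_fun_has_ubound[M hM] := cvgP _ h.
exists (M + normc l) => n; rewrite -[u n](subrK l).
by apply: le_trans (le_normcD _ _) _; rewrite lerD2r; apply: hM; exists n.
Qed.

End InfiniteProducts.

(** * Dominated convergence for sums over finite lists *)

Section Tannery.
Variables (R : realType) (T : choiceType) (w : T -> R) (M : R).
Local Notation K := (R[i] : numFieldType).
Import Normc.
Hypothesis wM : forall s, uniq s -> \sum_(x <- s) w x <= M.

(** A list [s0] whose [w]-sum is within e/2 of the supremum of all such sums leaves a tail of at
    most e/2, uniformly in N; on [s0] only finitely many terms have to tend to 0. *)
Lemma tannery0 (F : nat -> T -> K) (s : nat -> seq T) :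
  (forall N x, normc (F N x) <= w x) ->
  (forall x, F N x @[N --> \oo] --> (0 : K))%classic ->
  (forall N, uniq (s N)) ->
  (\sum_(x <- s N) F N x @[N --> \oo] --> (0 : K))%classic.
Proof.
move=> Fw F0 us; apply: cvg_normc; under eq_fun do rewrite subr0.
pose A := [set t : R | exists2 s, uniq s & t = \sum_(x <- s) w x]%classic.
have hA : has_sup A.
  split; first by exists 0; exists [::]; rewrite ?big_nil.
  by exists M => _ [s' us' ->]; exact: wM.
apply/cvgr0Pnorm_lt => e e0.
have e20 : 0 < e / 2 by rewrite divr_gt0.
have [_ [s0 us0 ->] hs0] := sup_adherent e20 hA.
have S0 : ((\sum_(x <- s0) normc (F N x) : R^o) @[N --> \oo] --> (0 : R^o))%classic.
  elim: s0 {us0 hs0} => [|x s1 IH].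
    by under eq_fun do rewrite big_nil; exact: cvg_cst.
  under eq_fun do rewrite big_cons.
  have := F0 x => /normc_cvg /=; under eq_fun do rewrite subr0.
  by move=> /cvgD /(_ IH); rewrite addr0.
move/cvgr0Pnorm_lt: S0 => /(_ _ e20); apply: filterS => N hN.
rewrite ger0_norm ?normc_ge0 //.
apply: le_lt_trans (normc_sum_le _ _ _) _.
rewrite (bigID (mem s0)) /= [e]splitr; apply: ltr_leD.
  apply: le_lt_trans _ hN; rewrite ger0_norm ?sumr_ge0 // => [|*]; last exact: normc_ge0.
  rewrite -big_filter.
  rewrite [leRHS](bigID (mem (s N))) /=.
  rewrite -[leLHS]addr0 lerD ?sumr_ge0 // => [|*]; last exact: normc_ge0.
  rewrite -[leRHS]big_filter (perm_big [seq x <- s0 | x \in s N]) //.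
  by apply: uniq_perm => [||x]; rewrite ?filter_uniq // !mem_filter andbC.
apply: (@le_trans _ _ (\sum_(x <- s N | x \notin s0) w x)); first exact: ler_sum.
rewrite -big_filter.
(* Prolonging [s0] by the remaining indices gives another admissible list, so they add at most the
   gap between [s0] and the supremum. *)
have us1 : uniq (s0 ++ [seq x <- s N | x \notin s0]).
  rewrite cat_uniq us0 filter_uniq // andbT -all_predC.
  by apply/allP => x; rewrite mem_filter => /andP[].
have : \sum_(x <- s0 ++ [seq x <- s N | x \notin s0]) w x <= sup A.
  by apply: ub_le_sup; [case: hA|exists (s0 ++ [seq x <- s N | x \notin s0])].
rewrite big_cat /= => h; move: hs0; rewrite ltrBlDr => /ltW hs0.
by rewrite -(lerD2l (\sum_(x <- s0) w x)); exact: le_trans h _.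
Qed.

Lemma sum_subseq_indicator (V : nmodType) (h : T -> V) (s u : seq T) :
  uniq s -> uniq u -> {subset s <= u} ->
  \sum_(x <- s) h x = \sum_(x <- u) if x \in s then h x else 0.
Proof.
move=> us uu su; rewrite -big_mkcond /= -[RHS]big_filter; apply/perm_big/uniq_perm => //.
  exact: filter_uniq.
by move=> x; rewrite mem_filter; case: (boolP (x \in s)) => // /su.
Qed.

(** Both sums are extended by 0 to the union of their ranges. The termwise differences are dominated
    by [w] as two halves, and tend to 0 because each index eventually lies in both ranges. *)
Lemma tannery_exhaustion (f : nat -> T -> K) (g : T -> K) (s t : nat -> seq T) :
  (forall N x, normc (f N x) <= w x / 2) -> (forall x, normc (g x) <= w x / 2) ->
  (forall x, f N x @[N --> \oo] --> g x)%classic ->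
  (forall N, uniq (s N)) -> (forall N, uniq (t N)) ->
  (forall x, \forall N \near \oo, x \in s N)%classic ->
  (forall x, \forall N \near \oo, x \in t N)%classic ->
  ((\sum_(x <- s N) f N x - \sum_(x <- t N) g x) @[N --> \oo] --> (0 : K))%classic.
Proof.
move=> fw gw fg us ut es et.
pose F N x := (if x \in s N then f N x else 0) - (if x \in t N then g x else 0).
have -> : (fun N => \sum_(x <- s N) f N x - \sum_(x <- t N) g x)
    = (fun N => \sum_(x <- undup (s N ++ t N)) F N x).
  apply/funext => N; rewrite /F sumrB.
  by congr (_ - _); apply: sum_subseq_indicator; rewrite ?undup_uniq // => x xs;
    rewrite mem_undup mem_cat xs ?orbT.
apply: tannery0 => [N x|x|N]; last exact: undup_uniq.
- rewrite [w x]splitr /F; apply: le_trans (le_normcD _ _) _; rewrite normcN.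
  have w0 : 0 <= w x / 2 by exact: le_trans (normc_ge0 _) (gw x).
  by apply: lerD; case: ifP => _; rewrite ?normc0.
- have : (f N x - g x @[N --> \oo] --> (0 : K))%classic by apply/subr_cvg0.
  apply: cvg_trans; apply: near_eq_cvg; near=> N.
  rewrite /F ifT; last by near: N.
  by rewrite ifT //; near: N.
Unshelve. all: by end_near. Qed.

End Tannery.

(** * The finite Jacobi triple product *)

Definition zbox (M : nat) : seq int :=
  [seq Posz i | i <- iota 0 M.+1] ++ [seq Negz i | i <- iota 0 M].

Lemma mem_zbox (M : nat) (m : int) : (m \in zbox M) = (`|m| <= M)%N.
Proof.
rewrite mem_cat; apply/idP/idP.
  by case/orP => /(@mapP nat int)[i + ->]; rewrite mem_iota /=; lia.
case: m => k h; apply/orP; [left|right]; apply/(@mapP nat int);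
  by exists k; rewrite ?mem_iota //=; lia.
Qed.

Lemma zbox_uniq M : uniq (zbox M).
Proof.
rewrite cat_uniq !map_inj_uniq ?iota_uniq //=; try by move=> i j [].
rewrite andbT -all_predC; apply/allP => x /(@mapP nat int)[i _ ->] /=.
by apply/negP => /(@mapP nat int)[].
Qed.

Lemma sum_zbox_shift (V : nmodType) (f : int -> V) N :
  \sum_(m <- zbox N) f m = \sum_(k < (N + N).+1) f (k%:Z - N%:Z).
Proof.
rewrite -(big_mkord xpredT (fun k => f (k%:Z - N%:Z))).
rewrite /index_iota subn0 -(big_map (fun k : nat => k%:Z - N%:Z) xpredT f).
apply/perm_big/uniq_perm; first exact: zbox_uniq.
  by rewrite map_inj_uniq ?iota_uniq // => i j /addIr [].
move=> m; rewrite mem_zbox; apply/idP/(@mapP nat int) => [h|[k + ->]].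
  by exists (absz (m + N%:Z)); rewrite ?mem_iota; lia.
by rewrite mem_iota; lia.
Qed.

(** * A summable weight on Z and on Z x Z *)

Section GeometricWeight.
Variable R : realType.

(** The terms of the Jacobi series decay faster than any geometric sequence, so the ratio 1/2 is
    enough to dominate them. *)
Definition dyadic (m : int) : R := 2^-1 ^+ `|m|.

Lemma dyadic_ge0 (m : int) : 0 <= dyadic m.
Proof. by rewrite exprn_ge0. Qed.

Lemma sum_dyadic_zbox M : \sum_(m <- zbox M) dyadic m <= 4.
Proof.
have h n : \sum_(0 <= j < n) (2^-1 : R) ^+ j <= 2.
  rewrite [leRHS](_ : 2 = (1 - 2^-1)^-1 :> R); last by field.
  by apply: sum_expr_le; apply/andP; split; lra.
rewrite big_cat !big_map /=.
have -> : 4 = 2 + 2 :> R by lra.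
apply: lerD; first by move: (h M.+1); rewrite /index_iota subn0.
apply: le_trans (h M); rewrite /index_iota subn0; apply: ler_sum => i _.
by rewrite /dyadic /= exprS ler_piMl ?exprn_ge0 //; lra.
Qed.

Lemma sum_dyadic2 (s : seq (int * int)) : uniq s ->
  \sum_(x <- s) dyadic x.1 * dyadic x.2 <= 16.
Proof.
move=> us.
(* A finite set of pairs fits in a square box, over which the sum factors. *)
pose M := \max_(x <- s) maxn `|x.1| `|x.2|.
pose b := [seq (i, j) | i <- zbox M, j <- zbox M].
have ub : uniq b.
  by apply: allpairs_uniq; rewrite ?zbox_uniq // => -[i j] [k l].
rewrite (@sum_subseq_indicator _ _ _ s b) // => [|x xs]; last first.
  have : (maxn `|x.1| `|x.2| <= M)%N by rewrite /M; apply: leq_bigmax_seq.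
  rewrite geq_max => /andP[h1 h2]; case: x h1 h2 {xs} => i j /= h1 h2.
  by apply/allpairsP; exists (i, j); rewrite !mem_zbox.
apply: (@le_trans _ _ (\sum_(x <- b) dyadic x.1 * dyadic x.2)).
  by apply: ler_sum => x _; case: ifP => // _; rewrite mulr_ge0 ?dyadic_ge0.
rewrite big_allpairs /=.
under eq_bigr do rewrite -mulr_sumr.
rewrite -mulr_suml (_ : 16 = 4 * 4); last by lra.
by apply: ler_pM; rewrite ?sum_dyadic_zbox // sumr_ge0 // => *; exact: dyadic_ge0.
Qed.

End GeometricWeight.

(** This is m(m - 1)/2, nonnegative for every integer m; [Negz k] stands for -(k + 1), whence (k +
    1)(k + 2)/2. *)
Definition tri (m : int) : nat :=
  match m with Posz k => 'C(k, 2) | Negz k => 'C(k.+2, 2) end.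

Lemma bin2_double k : ('C(k, 2) * 2)%N = (k * k.-1)%N.
Proof. by elim: k => // k IH; rewrite binS mulnDl IH bin1 /=; case: k {IH} => //=; nia. Qed.

Lemma tri_double (m : int) : (tri m)%:Z * 2 = m * (m - 1).
Proof.
case: m => k; first by have := bin2_double k; case: k => //=; nia.
by have /= := bin2_double k.+2; rewrite NegzE; nia.
Qed.

(** * The q-binomial theorem in base p and its symmetric form *)

Section FiniteJacobi.
Variables (F : fieldType) (p : F).

Definition poch (n : nat) : F := \prod_(0 <= j < n) (1 - p ^+ j.+1).

Hypothesis p_generic : forall j, 1 - p ^+ j.+1 != 0.

Lemma pochS n : poch n.+1 = poch n * (1 - p ^+ n.+1).
Proof. by rewrite /poch big_nat_recr. Qed.

Lemma poch_neq0 n : poch n != 0.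
Proof.
elim: n => [|n IH]; first by rewrite /poch big_geq // oner_neq0.
by rewrite pochS mulf_neq0.
Qed.

(** Gaussian binomial coefficient in base p. For k > M truncated subtraction gives a junk value; it
    enters no sum below, but [gauss_bounded] covers it because the domination must hold at every
    index. *)
Definition gauss (M k : nat) : F := poch M / (poch k * poch (M - k)).

Lemma gauss0 M : gauss M 0 = 1.
Proof. by rewrite /gauss subn0 {2}/poch big_geq // mul1r divff // poch_neq0. Qed.

Lemma gaussnn M : gauss M M = 1.
Proof. by rewrite /gauss subnn {3}/poch big_geq // mulr1 divff // poch_neq0. Qed.

Lemma gaussS M k : (k < M)%N ->
  gauss M.+1 k.+1 = gauss M k.+1 + p ^+ (M - k) * gauss M k.
Proof.
move=> kM; rewrite /gauss subSS.
have -> : (M - k = (M - k.+1).+1)%N by lia.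
set d := (M - k.+1)%N; have Md : M = (d + k).+1 by rewrite /d; lia.
rewrite !pochS [in p ^+ M.+1]Md.
have h1 := poch_neq0 k; have h2 := poch_neq0 d.
have h3 := p_generic k; have h4 := p_generic d.
rewrite (_ : (d + k).+2 = d.+1 + k.+1)%N; last lia.
rewrite exprD; move: h3 h4; set u := p ^+ d.+1; set v := p ^+ k.+1 => h3 h4.
by field; rewrite h1 h2 h3 h4.
Qed.

(** Induction on M with the q-Pascal rule [gaussS]. *)
Lemma gauss_binomial (t : F) M :
  \prod_(0 <= j < M) (1 - p ^+ j * t) =
  \sum_(k < M.+1) gauss M k * ((-1) ^+ k * p ^+ 'C(k, 2) * t ^+ k).
Proof.
pose g k := (-1) ^+ k * p ^+ 'C(k, 2) * t ^+ k.
rewrite -[RHS]/(\sum_(k < M.+1) gauss M k * g k).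
elim: M => [|M IH].
  by rewrite big_geq // big_ord1 gauss0 /g /= !expr0 !mulr1.
rewrite big_nat_recr //= {}IH mulrBr mulr1.
(* The new factor sends the k-th term to the (k+1)-st one, with exactly the power of p of the
   q-Pascal rule. *)
have gS k : (k <= M)%N -> g k * (p ^+ M * t) = - (p ^+ (M - k) * g k.+1).
  move=> kM; rewrite /g binS bin1 !exprD !exprS -{1}(subnK kM) exprD; ring.
rewrite [RHS]big_ord_recl [X in _ = _ + X]big_ord_recr /= /bump !add1n !gauss0 !gaussnn.
under [X in _ = _ + (X + _)]eq_bigr => k _ do rewrite /bump add1n gaussS // mulrDl.
rewrite big_split /= [X in X - _]big_ord_recl /= gauss0.
rewrite mulr_suml.
under [X in _ - X]eq_bigr => k _ do rewrite -mulrA gS -1?ltnS // mulrN.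
rewrite sumrN opprK big_ord_recr /= subnn gaussnn.
rewrite -!addrA; congr (_ + (_ + _)).
by congr (_ + _); [apply: eq_bigr => k _; ring | ring].
Qed.

(** The q-binomial theorem with 2N factors at t = x p^(-N). The upper N factors are the 1 - p^j x;
    from the lower ones, in reverse order, -x p^(-j-1) is pulled out, leaving 1 - p^(j+1)/x. *)
Lemma finite_jacobi (x : F) N : p != 0 -> x != 0 ->
  \prod_(0 <= j < N) ((1 - p ^+ j * x) * (1 - p ^+ j.+1 / x)) =
  \sum_(m <- zbox N) gauss (N + N) (absz (N%:Z + m)) *
     ((-1) ^ m * p ^+ tri m * x ^ m).
Proof.
move=> p0 x0.
have E := gauss_binomial (x * p ^- N) (N + N).
have H : \prod_(0 <= j < N + N) (1 - p ^+ j * (x * p ^- N)) =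
   (\prod_(0 <= j < N) ((1 - p ^+ j * x) * (1 - p ^+ j.+1 / x)))
   * ((- x) ^+ N * p ^- 'C(N.+1, 2)).
  rewrite (@big_cat_nat _ _ _ N) ?leq_addr //=.
  have := big_addn 0 (N + N) N xpredT (fun j => 1 - p ^+ j * (x * p ^- N)).
  rewrite add0n addnK => -> /=.
  have -> : \prod_(0 <= j < N) (1 - p ^+ (j + N) * (x * p ^- N))
      = \prod_(0 <= j < N) (1 - p ^+ j * x).
    by apply: eq_bigr => j _; rewrite exprD; field; rewrite ?p0 ?expf_neq0.
  rewrite big_split /= mulrC -mulrA; congr (_ * _).
  rewrite big_nat_rev /= add0n.
  have -> : \prod_(0 <= j < N) (1 - p ^+ (N - j.+1) * (x * p ^- N))
      = \prod_(0 <= j < N) ((1 - p ^+ j.+1 / x) * (- x * p ^- j.+1)).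
    apply: eq_big_nat => j /andP[_ jN].
    rewrite -[X in p ^- X](subnK jN) exprD.
    by field; rewrite ?p0 ?x0 ?expf_neq0.
  rewrite big_split /=; congr (_ * _).
  elim: N {E} => [|N IH]; first by rewrite big_geq // !expr0 invr1 mulr1.
  rewrite big_nat_recr //= IH (binS N.+1) bin1 exprD (exprS (- x)).
  have := expf_neq0 N.+1 p0; have := expf_neq0 'C(N.+1, 2) p0.
  move: (p ^+ N.+1) (p ^+ 'C(N.+1, 2)) ((- x) ^+ N) => u v w u0 v0.
  by field; rewrite u0 v0.
rewrite sum_zbox_shift.
apply: (mulIf (x := (- x) ^+ N * p ^- 'C(N.+1, 2))).
  by rewrite mulf_neq0 ?invr_eq0 ?expf_neq0 // oppr_eq0.
rewrite -H E mulr_suml; apply: eq_bigr => k _.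
rewrite addrC subrK absz_nat -[RHS]mulrA; congr (gauss _ _ * _).
(* With m = k - N, m(m - 1)/2 + Nk = k(k - 1)/2 + N(N + 1)/2. *)
have pE : p ^+ tri (k%:Z - N%:Z) * p ^+ (N * k) = p ^+ 'C(k, 2) * p ^+ 'C(N.+1, 2).
  rewrite -!exprD; congr (_ ^+ _).
  have h1 := tri_double (k%:Z - N%:Z).
  have h2 := bin2_double k; have h3 := bin2_double N.+1.
  by case: (nat_of_ord k) h1 h2 => [|k'] /= h1 h2; nia.
rewrite exprMn exprVn -exprM (exprNn x) !expfzDr ?oppr_eq0 ?oner_neq0 //.
rewrite -![_ ^ (- N%:Z)]exprnN -![_ ^ k%:Z]exprnP.
apply: (mulIf (x := p ^+ (N * k) * p ^+ 'C(N.+1, 2))); first by rewrite mulf_neq0 ?expf_neq0.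
have s1 : (-1) ^- N * (-1) ^+ N = 1 :> F by rewrite mulVf // expf_neq0 // oppr_eq0 oner_neq0.
have s0 : (-1) ^+ N != 0 :> F by rewrite expf_neq0 // oppr_eq0 oner_neq0.
transitivity ((-1) ^+ k * x ^+ k * (p ^+ 'C(k, 2) * p ^+ 'C(N.+1, 2))).
  have := expf_neq0 (N * k) p0; move: (p ^+ (N * k)) => u u0.
  by field.
have := expf_neq0 'C(N.+1, 2) p0; have := expf_neq0 N x0.
rewrite -pE; move: (p ^+ (N * k)) (p ^+ tri _) (x ^+ N) ((-1) ^+ N) (p ^+ 'C(N.+1, 2)) s0.
by move=> u v w y z y0 w0 z0; field; rewrite w0 y0 z0.
Qed.

End FiniteJacobi.

(** * The three-term relation for theta *)

Section Theta.
Variables (R : realType).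
Local Notation K := (R[i] : numFieldType).
Variable p : K.
Import Normc.
Hypotheses (p0 : p != 0) (p1 : normc p < 1).

Lemma normcX (x : K) n : normc (x ^+ n) = normc x ^+ n :> R.
Proof. by elim: n => [|n IH]; rewrite ?normc1 // !exprS normcM IH. Qed.

Lemma normc_exp_le1 n : normc (p ^+ n) <= 1.
Proof. by rewrite normcX exprn_ile1 ?normc_ge0 // ltW. Qed.

Lemma normp01 : 0 <= normc p < 1.
Proof. by rewrite normc_ge0. Qed.

(** [theta] is defined through [lim], so convergence has to be known before its product can be used:
    the j-th factor is 1 + O(|p|^j). *)
Lemma theta_cvg (x : K) :
  ((\prod_(0 <= j < m) ((1 - p ^+ j * x) * (1 - p ^+ j.+1 / x)))
     @[m --> \oo] --> theta p x)%classic.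
Proof.
pose d j : K := - (p ^+ j * x) - p ^+ j.+1 / x + p ^+ j * x * (p ^+ j.+1 / x).
have E m : \prod_(0 <= j < m) ((1 - p ^+ j * x) * (1 - p ^+ j.+1 / x))
    = \prod_(0 <= j < m) (1 + d j).
  by apply: eq_bigr => j _; rewrite /d; ring.
suff : cvg ((\prod_(0 <= j < m) (1 + d j)) @[m --> \oo])%classic.
  by rewrite /theta; under eq_fun do rewrite -E.
pose C := normc x + normc x^-1 + normc x * normc x^-1.
apply: (@cvg_prod_geometric _ d C (normc p) normp01) => j.
have hS : normc (p ^+ j.+1) <= normc p ^+ j.
  by rewrite exprS normcM normcX ler_piMl ?exprn_ge0 ?normc_ge0 // ltW.
have hj : 0 <= normc p ^+ j by rewrite exprn_ge0 ?normc_ge0.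
rewrite /d /C !mulrDl; apply: le_trans (le_normcD _ _) _; apply: lerD.
  apply: le_trans (le_normcD _ _) _; rewrite !normcN !normcM; apply: lerD.
    by rewrite normcX mulrC.
  by rewrite mulrC ler_wpM2l ?normc_ge0.
rewrite !normcM normcX mulrACA mulrC ler_wpM2l ?mulr_ge0 ?normc_ge0 //.
by rewrite ler_piMr // normc_exp_le1.
Qed.

Lemma p_generic j : 1 - p ^+ j.+1 != 0.
Proof.
apply/eqP => /subr0_eq /(congr1 (@normc R)); rewrite normc1 normcX => h.
by have := @exprn_ilt1 _ j.+1 _ (normc_ge0 p) p1; rewrite -h ltxx.
Qed.

Lemma poch_cvg : cvg (poch p n @[n --> \oo])%classic.
Proof.
apply: (@cvg_prod_geometric _ (fun j => - p ^+ j.+1) 1 (normc p) normp01) => j.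
rewrite normcN normcX mul1r exprS ler_piMl ?exprn_ge0 ?normc_ge0 //.
exact: ltW.
Qed.

(** 1/(1 - p^(j+1)) = 1 + p^(j+1)/(1 - p^(j+1)), where the denominator has modulus at least 1 -
    |p|. *)
Lemma poch_inv_cvg : cvg ((poch p n)^-1 @[n --> \oo])%classic.
Proof.
pose d j := p ^+ j.+1 / (1 - p ^+ j.+1).
have -> : (fun n => (poch p n)^-1) = (fun n => \prod_(0 <= j < n) (1 + d j)).
  apply/funext => n; rewrite /poch -prodfV; apply: eq_bigr => j _.
  by rewrite /d; field; exact: p_generic.
have h1 : 0 < 1 - normc p by rewrite subr_gt0.
apply: (@cvg_prod_geometric _ d (1 - normc p)^-1 (normc p) normp01) => j.
rewrite /d normcM normcV mulrC.
have hS : normc (p ^+ j.+1) <= normc p.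
  by rewrite exprS normcM ler_piMr ?normc_ge0 // normc_exp_le1.
apply: ler_pM; rewrite ?normc_ge0 ?invr_ge0 ?normc_ge0 //.
  rewrite lef_pV2 ?posrE //; last first.
    rewrite lt_def normc_ge0 andbT; apply/eqP => /eq0_normc h.
    by have := p_generic j; rewrite h eqxx.
  have := le_normcD (1 - p ^+ j.+1) (p ^+ j.+1).
  rewrite subrK normc1; lra.
by rewrite exprS normcM normcX ler_piMl ?exprn_ge0 ?normc_ge0 // ltW.
Qed.

(** 1/(p;p)_oo as a limit of inverses: [lim_poch_pochV] then follows by multiplying limits, with no
    separate proof that the limit of [poch] is nonzero. *)
Definition pochV_oo : K := lim ((poch p n)^-1 @[n --> \oo])%classic.

Lemma lim_poch_pochV :
  (lim (poch p n @[n --> \oo]) * pochV_oo)%classic = 1 :> K.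
Proof.
have h := cvgM poch_cvg poch_inv_cvg.
move: h; have -> : (poch p \* (fun n => (poch p n)^-1)) = (fun=> 1 : K).
  by apply/funext => n /=; rewrite divff // poch_neq0 //; exact: p_generic.
move=> /(_ _) h; rewrite -(cvg_lim (@norm_hausdorff _ _) h).
by rewrite lim_cst //; exact: norm_hausdorff.
Qed.

Lemma cvg_nat_shift (h : nat -> nat) k : (forall N, N <= h N + k)%N ->
  (h N @[N --> \oo] --> \oo)%classic.
Proof.
move=> hk A [n0 _ An]; exists (n0 + k)%N => // N /= le_N.
by apply: An => /=; rewrite -(leq_add2r k) (leq_trans le_N).
Qed.

(** For large N the coefficient is (p;p)_(2N) / ((p;p)_(N+m) (p;p)_(N-m)), and all three indices
    tend to infinity. *)
Lemma gauss_cvg (m : int) :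
  (gauss p (N + N) `|N%:Z + m| @[N --> \oo] --> pochV_oo)%classic.
Proof.
have -> : pochV_oo = lim (poch p n @[n --> \oo])%classic * (pochV_oo * pochV_oo).
  by rewrite mulrA lim_poch_pochV mul1r.
rewrite /gauss; under eq_fun do rewrite invfM.
have H (h : nat -> nat) k : (forall N, N <= h N + k)%N ->
    ((poch p (h N))^-1 @[N --> \oo] --> pochV_oo)%classic.
  move=> hk. exact: (cvg_comp _ _ (cvg_nat_shift hk) poch_inv_cvg).
apply: cvgM; last apply: cvgM.
- have hk N : (N <= (N + N) + 0)%N by lia.
  by exact: (cvg_comp _ _ (cvg_nat_shift hk) poch_cvg).
- by apply: (H _ `|m|%N) => N; lia.
- by apply: (H _ `|m|%N) => N; lia.
Qed.

Lemma gauss_bounded : exists M, forall k l, normc (gauss p k l) <= M.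
Proof.
have [M1 h1] := cvg_normc_bounded poch_cvg.
have [M2 h2] := cvg_normc_bounded poch_inv_cvg.
exists (M1 * (M2 * M2)) => k l; rewrite /gauss invfM !normcM.
by rewrite !ler_pM ?mulr_ge0 ?normc_ge0.
Qed.

(** General term of the Jacobi triple product series, whose sum over m is (p;p)_oo theta(x). *)
Definition jterm (x : K) (m : int) : K := (-1) ^ m * p ^+ tri m * x ^ m.

Lemma jterm_dyadic (x : K) : exists2 b, 0 <= b &
  forall m, normc (jterm x m) <= b * dyadic R m.
Proof.
(* Z bounds both |x| and |1/x|, so one estimate serves both signs of m. *)
pose r := normc p; pose Z := normc x + normc x^-1.
have Z0 : 0 <= Z by rewrite addr_ge0 ?normc_ge0.
have r0 : 0 <= r by exact: normc_ge0.
exists (expR (2 * Z * (1 - r)^-1)); first exact: expR_ge0.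
(* Each factor Z r^j is half of 2 Z r^j, and the product of the latter stays below that of the 1 + 2
   Z r^j. *)
have bound k : r ^+ 'C(k, 2) * Z ^+ k <= expR (2 * Z * (1 - r)^-1) * 2^-1 ^+ k.
  have -> : r ^+ 'C(k, 2) * Z ^+ k
      = (\prod_(0 <= j < k) (2 * Z * r ^+ j)) * 2^-1 ^+ k.
    elim: k => [|k IH]; first by rewrite big_geq // !mulr1.
    rewrite big_nat_recr //= binS bin1 exprD !exprS.
        transitivity (r ^+ 'C(k, 2) * Z ^+ k * (r ^+ k * Z)); first by ring.
    by rewrite IH; field.
  rewrite ler_wpM2r ?exprn_ge0 //.
  apply: le_trans (prod_geometric_le k normp01 _); last by rewrite mulr_ge0.
  apply: ler_prod => j _; rewrite lerDr ler01 andbT.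
  by rewrite !mulr_ge0 ?exprn_ge0.
have sgn1 (m : int) : normc ((-1 : K) ^ m) = 1 :> R.
  by case: m => k; rewrite ?NegzE -?exprnN -?exprnP ?normcV normcX normcN normc1 expr1n ?invr1.
move=> m; rewrite /jterm !normcM sgn1 mul1r /dyadic.
case: m => k /=.
  apply: le_trans (bound k); rewrite -exprnP !normcX ler_wpM2l ?exprn_ge0 //.
  by rewrite lerXn2r ?nnegrE ?normc_ge0 // lerDl normc_ge0.
apply: le_trans (bound k.+1); rewrite NegzE -exprnN -exprVn !normcX.
apply: ler_pM; rewrite ?exprn_ge0 ?normc_ge0 //.
  by rewrite (binS k.+1) exprD ler_piMr ?exprn_ge0 // exprn_ile1 // ltW.
by rewrite lerXn2r ?nnegrE ?normc_ge0 // lerDr normc_ge0.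
Qed.

End Theta.

Lemma cvg_sub_eq (F : numFieldType) (f g : nat -> F) (l : F) :
  (f n @[n --> \oo] --> l)%classic -> ((f n - g n) @[n --> \oo] --> (0 : F))%classic ->
  (g n @[n --> \oo] --> l)%classic.
Proof.
move=> fl fg0; have -> : g = (fun n => f n - (f n - g n)).
  by apply/funext => n; rewrite opprB addrC subrK.
by rewrite -[l]subr0; exact: cvgB.
Qed.

Lemma plucker_cvg (F : numFieldType) (A B C D E G : nat -> F) (a b c d e g y u : F) :
  (A n @[n --> \oo] --> a)%classic -> (B n @[n --> \oo] --> b)%classic ->
  (C n @[n --> \oo] --> c)%classic -> (D n @[n --> \oo] --> d)%classic ->
  (E n @[n --> \oo] --> e)%classic -> (G n @[n --> \oo] --> g)%classic ->
  (forall n, A n * B n * y - C n * D n * u + E n * G n * u = 0) ->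
  a * b * y - c * d * u + e * g * u = 0.
Proof.
move=> Aa Bb Cc Dd Ee Gg h.
have : ((A n * B n * y - C n * D n * u + E n * G n * u)
    @[n --> \oo] --> (a * b * y - c * d * u + e * g * u))%classic.
  apply: cvgD; last by apply: cvgM; [exact: cvgM|exact: cvg_cst].
  by apply: cvgB; (apply: cvgM; [exact: cvgM|exact: cvg_cst]).
under eq_fun do rewrite h.
move=> /(cvg_lim (@norm_hausdorff _ _)) <-.
by rewrite lim_cst //; exact: norm_hausdorff.
Qed.

(* The Plücker relation for the 2x2 minors [O s * V t - V s * O t]. *)
Lemma plucker_det2 (A : comPzRingType) (c x y u v ox oy ou ov ex ey eu ev : A) :
  c * (x * (ox * ey - ex * oy)) * (c * (u * (ou * ev - eu * ov))) * y
  - c * (x * (ox * eu - ex * ou)) * (c * (y * (oy * ev - ey * ov))) * u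
  + c * (x * (ox * ev - ex * ov)) * (c * (y * (oy * eu - ey * ou))) * u = 0.
Proof. by ring. Qed.

(** * Products theta(xy) theta(x/y) as determinants of theta series *)

Section ThetaProducts.
Variables (R : realType).
Local Notation K := (R[i] : numFieldType).
Variable p : K.
Import Normc.
Hypotheses (p0 : p != 0) (p1 : normc p < 1).

(** Truncations of V, and next of O. The exponents j^2 and i(i + 1) are nonnegative, so the absolute
    value only casts them to [nat]. *)
Definition theta_even N (x : K) : K :=
  \sum_(j <- zbox N) p ^+ `|j * j| * x ^ (2 * j).
Definition theta_odd N (x : K) : K :=
  \sum_(i <- zbox N) p ^+ `|i * (i + 1)| * x ^ (2 * i + 1).

Lemma mulr4ACA (A : comPzRingType) (s t a b c d e f : A) :
  (s * a * (c * e)) * (t * b * (d * f)) = s * t * (a * b) * (c * d) * (e * f).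
Proof. by ring. Qed.

(** The index pairs (m, n) with m + n even: m + n = 2i + 2 and m - n = 2j separate the powers of x
    and y, the signs agree, and tri m + tri n = i(i + 1) + j^2. *)
Lemma jterm_lattice_odd (x y : K) (i j : int) : x != 0 -> y != 0 ->
  jterm p (x * y) (i + j + 1) * jterm p (x / y) (i - j + 1) =
  x * ((p ^+ `|i * (i + 1)| * x ^ (2 * i + 1)) * (p ^+ `|j * j| * y ^ (2 * j))).
Proof.
move=> x0 y0; rewrite /jterm.
have -> : (-1) ^ (i - j + 1) = (-1) ^ (i + j + 1) :> K.
  have -> : i - j + 1 = (i + j + 1) + (- j) * 2 by ring.
  rewrite (expfzDr (i + j + 1)) ?oppr_eq0 ?oner_neq0 // (mulrC (- j)) -exprz_exp.
  by rewrite -exprnP sqrrN expr1n exp1rz mulr1.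
have s1 : (-1) ^ (i + j + 1) * (-1) ^ (i + j + 1) = 1 :> K.
  by rewrite -expfzMl mulrNN mulr1 exp1rz.
have pE : p ^+ tri (i + j + 1) * p ^+ tri (i - j + 1) = p ^+ `|i * (i + 1)| * p ^+ `|j * j|.
  rewrite -!exprD; congr (_ ^+ _).
  by have h1 := tri_double (i + j + 1); have h2 := tri_double (i - j + 1); nia.
have xE : x ^ (i + j + 1) * x ^ (i - j + 1) = x * x ^ (2 * i + 1).
  rewrite -{3}[x]expr1z -!expfzDr //; congr (_ ^ _); ring.
have yE : y ^ (i + j + 1) * y^-1 ^ (i - j + 1) = y ^ (2 * j).
  by rewrite exprz_inv -expfzDr //; congr (_ ^ _); ring.
rewrite !expfzMl.
rewrite mulr4ACA s1 pE xE yE mul1r.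
move: (p ^+ _) (p ^+ _) (x ^ _) (y ^ _) => *; ring.
Qed.

(** The pairs with m + n odd: now m + n = 2j + 1 and m - n = 2i + 1, so x and y exchange their
    series, and the opposite signs give the minus of the determinant. *)
Lemma jterm_lattice_even (x y : K) (i j : int) : x != 0 -> y != 0 ->
  jterm p (x * y) (i + j + 1) * jterm p (x / y) (j - i) =
  - (x * ((p ^+ `|j * j| * x ^ (2 * j)) * (p ^+ `|i * (i + 1)| * y ^ (2 * i + 1)))).
Proof.
move=> x0 y0; rewrite /jterm.
have -> : (-1) ^ (i + j + 1) = - (-1) ^ (j - i) :> K.
  have -> : i + j + 1 = (j - i) + (i * 2 + 1) by ring.
  rewrite (expfzDr (j - i)) ?(expfzDr (i * 2)) ?oppr_eq0 ?oner_neq0 // (mulrC i).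
  by rewrite -exprz_exp -exprnP sqrrN expr1n exp1rz mul1r expr1z mulrN1.
have s1 : (-1) ^ (j - i) * (-1) ^ (j - i) = 1 :> K.
  by rewrite -expfzMl mulrNN mulr1 exp1rz.
have pE : p ^+ tri (i + j + 1) * p ^+ tri (j - i) = p ^+ `|i * (i + 1)| * p ^+ `|j * j|.
  rewrite -!exprD; congr (_ ^+ _).
  by have h1 := tri_double (i + j + 1); have h2 := tri_double (j - i); nia.
have xE : x ^ (i + j + 1) * x ^ (j - i) = x * x ^ (2 * j).
  rewrite -{3}[x]expr1z -!expfzDr //; congr (_ ^ _); ring.
have yE : y ^ (i + j + 1) * y^-1 ^ (j - i) = y ^ (2 * i + 1).
  by rewrite exprz_inv -expfzDr //; congr (_ ^ _); ring.
rewrite !expfzMl.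
rewrite !mulNr mulr4ACA s1 pE xE yE mul1r; congr (- _).
move: (p ^+ _) (p ^+ _) (x ^ _) (y ^ _) => *; ring.
Qed.

Definition box2 N : seq (int * int) := [seq (m, n) | m <- zbox N, n <- zbox N].

(** A second exhaustion of Z x Z, split by the parity of the sum of the coordinates; over each half
    the double sum factors into theta series. *)
Definition lattice2 N : seq (int * int) :=
  [seq (i + j + 1, i - j + 1) | i <- zbox N, j <- zbox N] ++
  [seq (i + j + 1, j - i) | i <- zbox N, j <- zbox N].

Lemma box2_uniq N : uniq (box2 N).
Proof. by apply: allpairs_uniq; rewrite ?zbox_uniq // => -[i j] [k l]. Qed.

Lemma lattice2_uniq N : uniq (lattice2 N).
Proof.
rewrite cat_uniq; apply/and3P; split.
- apply: allpairs_uniq; rewrite ?zbox_uniq // => -[i j] [k l] _ _ /= [].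
  by intros; congr (_, _); lia.
- rewrite -all_predC; apply/allP => -[a b] /allpairsP[[i j] /= [_ _ ->]] /=.
  apply/negP => h; have /allpairsP[[k l] /= [_ _ []]] :
    (i + j + 1, j - i) \in [seq (i + j + 1, i - j + 1) | i <- zbox N, j <- zbox N] := h.
  by lia.
- apply: allpairs_uniq; rewrite ?zbox_uniq // => -[i j] [k l] _ _ /= [].
  by intros; congr (_, _); lia.
Qed.

Lemma box2_exhausts (x : int * int) : (\forall N \near \oo, x \in box2 N)%classic.
Proof.
exists (`|x.1| + `|x.2|)%N => // N /= h.
by apply/allpairsP; exists x; rewrite !mem_zbox; case: x h => i j /=; split=> //; lia.
Qed.

Lemma lattice2_exhausts (x : int * int) : (\forall N \near \oo, x \in lattice2 N)%classic.
Proof.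
case: x => m n; exists (`|m| + `|n| + 1)%N => // N /= h; rewrite mem_cat.
(* k is the quotient of m + n by 2; the witnesses below invert the two parametrisations. *)
have [k [hk|hk]] : exists k : int, m + n = 2 * k \/ m + n = 2 * k + 1.
  by exists (divz (m + n) 2); lia.
- apply/orP; left; apply/allpairsP; exists (k - 1, m - k) => /=.
  by rewrite !mem_zbox; split; [lia|lia|congr (_, _); lia].
- apply/orP; right; apply/allpairsP; exists (m - k - 1, k) => /=.
  by rewrite !mem_zbox; split; [lia|lia|congr (_, _); lia].
Qed.

(** The finite triple products give a sum over [box2 N] whose terms tend to those of [g]. By
    dominated convergence the sum of [g] over [lattice2 N] has the same limit, and that sum is the
    determinant. *)
Lemma theta_mul_cvg (x y : K) : x != 0 -> y != 0 ->
  (pochV_oo p ^+ 2 * (x * (theta_odd N x * theta_even N y - theta_even N x * theta_odd N y))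
     @[N --> \oo] --> theta p (x * y) * theta p (x / y))%classic.
Proof.
move=> x0 y0.
pose g (u : int * int) : K :=
  pochV_oo p ^+ 2 * (jterm p (x * y) u.1 * jterm p (x / y) u.2).
have gE N : \sum_(u <- lattice2 N) g u =
    pochV_oo p ^+ 2 * (x * (theta_odd N x * theta_even N y - theta_even N x * theta_odd N y)).
  rewrite /g -mulr_sumr; congr (_ * _); rewrite big_cat !big_allpairs_dep /=.
  rewrite mulrBr; congr (_ + _).
    rewrite mulr_suml mulr_sumr; apply: eq_bigr => i _.
    rewrite !mulr_sumr; apply: eq_bigr => j _; exact: jterm_lattice_odd.
  rewrite (mulrC (theta_even N x)) mulr_suml mulr_sumr -sumrN.
  apply: eq_bigr => i _; rewrite !mulr_sumr -sumrN; apply: eq_bigr => j _.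
  by rewrite jterm_lattice_even // [X in x * X]mulrC.
pose B N m := gauss p (N + N) `|N%:Z + m|.
pose f N (u : int * int) : K :=
  B N u.1 * jterm p (x * y) u.1 * (B N u.2 * jterm p (x / y) u.2).
have xy0 : x * y != 0 by rewrite mulf_neq0.
have xVy0 : x / y != 0 by rewrite mulf_neq0 ?invr_eq0.
have fE N : \sum_(u <- box2 N) f N u =
   (\prod_(0 <= j < N) ((1 - p ^+ j * (x * y)) * (1 - p ^+ j.+1 / (x * y)))) *
   (\prod_(0 <= j < N) ((1 - p ^+ j * (x / y)) * (1 - p ^+ j.+1 / (x / y)))).
  rewrite !finite_jacobi //; try by move=> j; exact: p_generic.
  rewrite big_allpairs /= mulr_suml; apply: eq_bigr => m _.
  by rewrite mulr_sumr.
have [M hM] := gauss_bounded p1.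
have [b1 b10 hb1] := jterm_dyadic p1 (x * y).
have [b2 b20 hb2] := jterm_dyadic p1 (x / y).
have M0 : 0 <= M by exact: le_trans (normc_ge0 _) (hM 0%N 0%N).
pose L := normc (pochV_oo p); have hL : normc (pochV_oo p) <= L by [].
have L0 : 0 <= L by exact: normc_ge0.
(* M^2 bounds the Gaussian coefficients and L^2 their limit; the factor 2 offsets the halving in
   [tannery_exhaustion]. *)
pose w (u : int * int) : R :=
  2 * (b1 * b2 * (M ^+ 2 + L ^+ 2)) * (dyadic R u.1 * dyadic R u.2).
have wM s : uniq s -> \sum_(u <- s) w u <= 2 * (b1 * b2 * (M ^+ 2 + L ^+ 2)) * 16.
  move=> us; rewrite -mulr_sumr ler_wpM2l ?sum_dyadic2 //.
  by rewrite !mulr_ge0 // addr_ge0 // exprn_ge0.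
have wE u : w u / 2 = (M ^+ 2 + L ^+ 2) * ((b1 * dyadic R u.1) * (b2 * dyadic R u.2)).
  by rewrite /w; field.
have jj u : normc (jterm p (x * y) u.1) * normc (jterm p (x / y) u.2)
    <= (b1 * dyadic R u.1) * (b2 * dyadic R u.2).
  by rewrite ler_pM ?normc_ge0.
have H : ((\sum_(u <- box2 N) f N u - \sum_(u <- lattice2 N) g u)
    @[N --> \oo] --> (0 : K))%classic.
  apply: (tannery_exhaustion wM) => [N u|u|u|N|N|u|u].
  - rewrite wE /f mulrACA normcM; apply: ler_pM; rewrite ?normc_ge0 //.
      rewrite normcM; apply: (@le_trans _ _ (M ^+ 2)); last by rewrite lerDl exprn_ge0.
      by rewrite expr2; apply: ler_pM; rewrite ?normc_ge0 //; exact: hM.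
    by rewrite normcM.
  - rewrite wE /g normcM; apply: ler_pM; rewrite ?normc_ge0 //.
      rewrite expr2 normcM; apply: (@le_trans _ _ (L ^+ 2)); last by rewrite lerDr exprn_ge0.
      by rewrite expr2 ler_pM ?normc_ge0.
    by rewrite normcM.
  - have -> : g u = pochV_oo p * jterm p (x * y) u.1 * (pochV_oo p * jterm p (x / y) u.2).
      by rewrite /g expr2 [RHS]mulrACA.
    by apply: cvgM; apply: cvgM; try exact: cvg_cst; exact: gauss_cvg.
  - exact: box2_uniq.
  - exact: lattice2_uniq.
  - exact: box2_exhausts.
  - exact: lattice2_exhausts.
have T : (\sum_(u <- box2 N) f N u @[N --> \oo]
    --> theta p (x * y) * theta p (x / y))%classic.
  by under eq_fun do rewrite fE; apply: cvgM; exact: theta_cvg.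
under eq_fun do rewrite -gE.
exact: (cvg_sub_eq T H).
Qed.

(** The truncated determinants satisfy the relation exactly for each N. The factors y, u, u make up
    for the prefactors in [theta_mul_cvg], so that every term carries x y u. *)
Lemma theta_addition (x y u v : K) : x != 0 -> y != 0 -> u != 0 -> v != 0 ->
  theta p (x * y) * theta p (x / y) * (theta p (u * v) * theta p (u / v)) * y
  - theta p (x * u) * theta p (x / u) * (theta p (y * v) * theta p (y / v)) * u
  + theta p (x * v) * theta p (x / v) * (theta p (y * u) * theta p (y / u)) * u = 0.
Proof.
move=> x0 y0 u0 v0.
have h := fun s t s0 t0 => @theta_mul_cvg s t s0 t0.
apply: (plucker_cvg (h x y x0 y0) (h u v u0 v0) (h x u x0 u0) (h y v y0 v0)
  (h x v x0 v0) (h y u y0 u0)) => N; exact: plucker_det2.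
Qed.

End ThetaProducts.

(** * Elliptic weights and elliptic numbers *)

Section ComplexExponential.
Variable R : realType.

Lemma cexpD (u v : R[i]) : cexp (u + v) = cexp u * cexp v.
Proof.
case: u v => a b [c d]; rewrite /cexp /= expRD cosD sinD; simpc.
by congr (_ +i* _); ring.
Qed.

Lemma cexp0 : cexp (0 : R[i]) = 1.
Proof. by rewrite /cexp /= expR0 cos0 sin0 mul1r. Qed.

Lemma cexp_neq0 (u : R[i]) : cexp u != 0.
Proof.
apply/eqP => h; have := cexpD u (- u).
by rewrite subrr cexp0 h mul0r => /eqP; rewrite oner_eq0.
Qed.

Lemma cexp_int (u : R[i]) (m : int) : cexp (u * m%:~R) = cexp u ^ m.
Proof.
have nat_case (n : nat) : cexp (u * n%:R) = cexp u ^+ n.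
  elim: n => [|n IH]; first by rewrite mulr0 cexp0.
  by rewrite mulrSr mulrDr mulr1 cexpD IH exprSr.
case: m => n; first by rewrite -exprnP -nat_case.
apply: (mulIf (cexp_neq0 (u * n.+1%:R))).
rewrite -cexpD NegzE mulrNz -mulrDr addNr mulr0 cexp0 -exprnN nat_case mulVf //.
by rewrite expf_neq0 // cexp_neq0.
Qed.

End ComplexExponential.

Lemma thetas4 (K : numFieldType) (p s t u v : K) :
  thetas p [:: s; t; u; v] = theta p s * (theta p t * (theta p u * theta p v)).
Proof. by rewrite /thetas !big_cons big_nil mulr1. Qed.

Lemma thetas5 (K : numFieldType) (p r s t u v : K) :
  thetas p [:: r; s; t; u; v] =
  theta p r * (theta p s * (theta p t * (theta p u * theta p v))).
Proof. by rewrite /thetas !big_cons big_nil mulr1. Qed.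

Section EllipticShift.
Variable R : realType.
Variables (a b q p l z : R[i]).
Hypotheses (a0 : a != 0) (b0 : b != 0) (q0 : q != 0) (p0 : p != 0)
  (p1 : `|p| < 1) (lq : cexp l = q).
Local Notation T := (theta p).
Local Notation x := (cexp (l * z)).

(** [theta_addition] at (s w, s y q, s y, b q/s) with s a square root of a; s disappears from all
    arguments and the common factor s y is cancelled. It will be used with w = q^z and y = q^m. *)
Lemma theta_step (w y : R[i]) : w != 0 -> y != 0 ->
  q * (T (w / (y * q)) * T (a * w * (y * q)) * (T (b * (y * q)) * T (a * (y / q) / b)))
  - T (w / y) * T (a * w * y) * (T (b * (y * q ^+ 2)) * T (a * y / b))
  + T q * T (a * (y ^+ 2 * q)) * (T (b * (w * q)) * T (a * (w / q) / b)) = 0.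
Proof.
move=> w0 y0.
have [s s0 sE] : exists2 s : R[i], s != 0 & a = s ^+ 2.
  exists (sqrtc a); last by rewrite sqr_sqrtc.
  by apply: contra_neq a0 => h; rewrite -[a]sqr_sqrtc h expr0n.
have p1' : Normc.normc p < 1 by rewrite -ltcR -normrE_normc.
have sw0 : s * w != 0 by rewrite mulf_neq0.
have sy0 : s * y != 0 by rewrite mulf_neq0.
have syq0 : s * y * q != 0 by rewrite mulf_neq0.
have v0 : b * q / s != 0 by rewrite !mulf_neq0 ?invr_eq0.
have := @theta_addition R p p0 p1' (s * w) (s * y * q) (s * y) (b * q / s) sw0 syq0 sy0 v0.
have -> : s * w * (s * y * q) = a * w * (y * q) by rewrite sE; ring.
have -> : s * w / (s * y * q) = w / (y * q) by field; rewrite s0 y0 q0.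
have -> : s * y * (b * q / s) = b * (y * q) by field; rewrite s0.
have -> : s * y / (b * q / s) = a * (y / q) / b by rewrite sE; field; rewrite s0 b0 q0.
have -> : s * w * (s * y) = a * w * y by rewrite sE; ring.
have -> : s * w / (s * y) = w / y by field; rewrite s0 y0.
have -> : s * y * q * (b * q / s) = b * (y * q ^+ 2) by field; rewrite s0.
have -> : s * y * q / (b * q / s) = a * y / b by rewrite sE; field; rewrite s0 b0 q0.
have -> : s * w * (b * q / s) = b * (w * q) by field; rewrite s0.
have -> : s * w / (b * q / s) = a * (w / q) / b by rewrite sE; field; rewrite s0 b0 q0.
have -> : s * y * q * (s * y) = a * (y ^+ 2 * q) by rewrite sE; ring.
have -> : s * y * q / (s * y) = q by field; rewrite s0 y0.
move: (T (w / (y * q))) (T (a * w * (y * q))) (T (b * (y * q))) (T (a * (y / q) / b))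
  (T (w / y)) (T (a * w * y)) (T (b * (y * q ^+ 2))) (T (a * y / b))
  (T q) (T (a * (y ^+ 2 * q))) (T (b * (w * q))) (T (a * (w / q) / b)).
by move=> ? ? ? ? ? ? ? ? ? ? ? ? h; apply: (mulIf sy0); rewrite mul0r -[RHS]h; ring.
Qed.

(* [ell_shift m] is [W(m) [z - m]_{a q^(2m), b q^m}], with the factor
   [theta(a q^(2m + 1))] cancelled so that it is meaningful for every [m]. *)
Definition ell_shift (m : int) : R[i] :=
  T (b * q) * T (b * q ^+ 2) * T (a * q^-1 / b) * T (a / b)
    / (T q * T (b * (x * q)) * T (a * (x / q) / b) * T (a * q))
  * (T (x / q ^ m) * T (a * x * q ^ m) * q ^ m
    / (T (b * q ^ (m + 1)) * T (a * q ^ (m - 1) / b))).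

Hypothesis den0 : forall k : int, ell_weight_den a b q p k != 0.

Lemma ell_weight_den_neq0 (k : int) :
  [/\ T (a * q) != 0, T (b * q ^ (k + 1)) != 0, T (b * q ^ (k + 2)) != 0,
    T (a * q ^ (k - 1) / b) != 0 & T (a * q ^ k / b) != 0].
Proof.
have := den0 k; rewrite /ell_weight_den thetas5.
by rewrite !mulf_eq0 !negb_or => /and5P.
Qed.

(** One step of the addition formula, [theta_step] over a common denominator; every sum of weights
    telescopes by it. *)
Lemma ell_shiftS (m : int) : T q != 0 -> T (b * (x * q)) != 0 ->
  T (a * (x / q) / b) != 0 ->
  ell_shift (m + 1) - ell_shift m = - ell_weight a b q p m.
Proof.
move=> q1 bx1 ax1; have [aq1 h1 h2 h3 h4] := ell_weight_den_neq0 m.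
have y0 : q ^ m != 0 by rewrite expfz_neq0.
have S := theta_step (cexp_neq0 (l * z)) y0.
apply/eqP; rewrite -subr_eq0 opprK; apply/eqP.
rewrite /ell_shift /ell_weight /ell_weight_den !thetas5.
move: h1 h2 h3 h4.
have -> : q ^ (m + 1 + 1) = q ^ m * q ^+ 2 by rewrite -addrA expfzDr.
have -> : m + 1 - 1 = m by rewrite addrK.
have -> : q ^ (m + 2) = q ^ m * q ^+ 2 by rewrite expfzDr.
have -> : q ^ (m + 1) = q ^ m * q by rewrite expfzDr // expr1z.
have -> : q ^ (m - 1) = q ^ m / q by rewrite expfzDr // exprN1.
have -> : q ^ (2 * m + 1) = (q ^ m) ^+ 2 * q.
  by rewrite expfzDr // expr1z (mulrC 2) -exprz_exp.
move: S y0; move: (q ^ m) => y.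
move: (T (x / (y * q))) (T (a * x * (y * q))) (T (b * (y * q))) (T (a * (y / q) / b))
  (T (x / y)) (T (a * x * y)) (T (b * (y * q ^+ 2))) (T (a * y / b)).
move: q1 bx1 ax1 aq1.
move: (T q) (T (a * (y ^+ 2 * q))) (T (b * (x * q))) (T (a * (x / q) / b)) (T (a * q))
  (T (b * q)) (T (b * q ^+ 2)) (T (a * q^-1 / b)) (T (a / b)).
move=> t1 t2 t3 t4 t5 t6 t7 t8 t9 n1 n3 n4 n5 u1 u2 u3 u4 u5 u6 u7 u8 S y0 m3 m7 m4 m8.
transitivity ((q * (u1 * u2 * (u3 * u4)) - u5 * u6 * (u7 * u8) + t1 * t2 * (t3 * t4)) *
  (y * t6 * t7 * t8 * t9 / (t1 * t3 * t4 * t5 * u3 * u4 * u7 * u8))); last by rewrite S mul0r.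
by field; rewrite n1 n3 n4 n5 m3 m4 m7 m8.
Qed.

(** With m = -k, theta(a q^(2m+1)) cancels between weight and number. The other theta factors in the
    denominator of the number do not depend on k; their nonvanishing is returned for use in
    [ell_shiftS]. *)
Lemma ell_weight_ell_num (k : int) :
  ell_num_den (a * q ^ (- 2 * k)) (b * q ^ (- k)) q l p (z + k%:~R) != 0 ->
  [/\ T q != 0, T (b * (x * q)) != 0, T (a * (x / q) / b) != 0 &
    ell_weight a b q p (- k) *
      ell_num (a * q ^ (- 2 * k)) (b * q ^ (- k)) q l p (z + k%:~R) = ell_shift (- k)].
Proof.
have [aq1 h1 h2 h3 h4] := ell_weight_den_neq0 (- k).
rewrite /ell_num /ell_weight /ell_shift /ell_weight_den /ell_num_den.
rewrite !thetas4 !thetas5.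
set m := - k in h1 h2 h3 h4 *.
have y0 : q ^ m != 0 by rewrite expfz_neq0.
have -> : - 2 * k = 2 * m by rewrite /m mulrN mulNr.
have -> : q ^ (2 * m) = (q ^ m) ^+ 2 by rewrite (mulrC 2) -exprz_exp.
have ek : cexp (l * (z + k%:~R)) = x / q ^ m.
  by rewrite mulrDr cexpD cexp_int lq /m -invr_expz invrK.
have -> : cexp (l * (z + k%:~R + 1)) = x / q ^ m * q by rewrite mulrDr cexpD ek mulr1 lq.
have -> : cexp (l * (z + k%:~R - 1)) = x / q ^ m / q.
  by rewrite mulrBr cexpD ek mulr1 -[- l]mulrN1 -[-1]/((-1)%:~R) cexp_int lq exprN1.
rewrite ek; move: h1 h2 h3 h4.
have -> : q ^ (m + 2) = q ^ m * q ^+ 2 by rewrite expfzDr.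
have -> : q ^ (m + 1) = q ^ m * q by rewrite expfzDr // expr1z.
have -> : q ^ (m - 1) = q ^ m / q by rewrite expfzDr // exprN1.
have -> : q ^ (2 * m + 1) = (q ^ m) ^+ 2 * q.
  by rewrite expfzDr // expr1z (mulrC 2) -exprz_exp.
move: y0; move: (q ^ m) => y y0 h1 h2 h3 h4.
have x0 := cexp_neq0 (l * z).
have -> : a * y ^+ 2 * (x / y) = a * x * y by field.
have -> : b * y * q ^+ 2 = b * (y * q ^+ 2) by ring.
have -> : a * y ^+ 2 / (b * y) = a * y / b by field; rewrite y0 b0.
have -> : a * y ^+ 2 * q = a * (y ^+ 2 * q) by ring.
have -> : b * y * (x / y * q) = b * (x * q) by field.
have -> : a * y ^+ 2 * (x / y / q) / (b * y) = a * (x / q) / b.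
  by field; rewrite y0 b0 q0.
move: h1 h2 h3 h4 aq1.
move: (T (x / y)) (T (a * x * y)) (T (b * (y * q))) (T (a * (y / q) / b))
  (T (b * (y * q ^+ 2))) (T (a * y / b)).
move: (T q) (T (a * (y ^+ 2 * q))) (T (b * (x * q))) (T (a * (x / q) / b)) (T (a * q))
  (T (b * q)) (T (b * q ^+ 2)) (T (a * q^-1 / b)) (T (a / b)).
move=> t1 t2 t3 t4 t5 t6 t7 t8 t9 u1 u2 u3 u4 u7 u8 m3 m7 m4 m8 n5.
rewrite !mulf_eq0 !negb_or => /and4P[n1 n2 n3 n4]; split=> //.
by field; rewrite n1 n2 n3 n4 n5 m3 m4 m7 m8.
Qed.

Lemma ell_weight0 : ell_weight a b q p 0 = 1.
Proof.
have [h1 h2 h3 h4 h5] := ell_weight_den_neq0 0.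
move: h2 h3 h4 h5; rewrite /ell_weight /ell_weight_den !thetas5 mulr0 !add0r.
rewrite expr0z expr1z exprN1 mulr1 -exprnP => h2 h3 h4 h5.
move: h1 h2 h3 h4 h5.
move: (T (a * q)) (T (b * q)) (T (b * q ^+ 2)) (T (a * q^-1 / b)) (T (a / b)).
by move=> t1 t2 t3 t4 t5 h1 h2 h3 h4 h5; rewrite mulr1 divff // !mulf_neq0.
Qed.

End EllipticShift.

(** * Rook placements on the augmented board *)

Section Board.
Variables (n : nat) (av bv : 'I_n -> nat).
Local Notation cell := (Defs.cell av bv).
Local Notation col := (@Defs.col n av bv).
Local Notation row := (@Defs.row n av bv).
Implicit Types (P : {set cell}) (c d : cell) (i s : 'I_n).

Lemma psumAS i : psumA av i.+1 = (psumA av i + av i)%N.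
Proof.
rewrite /psumA (bigD1 i) //= addnC; congr (_ + _)%N; apply: eq_bigl => j.
by rewrite ltnS ltn_neqAle andbC.
Qed.

Lemma psumA0 : psumA av 0 = 0%N.
Proof. by rewrite /psumA big_pred0. Qed.

Lemma leq_psumA j k : (j <= k)%N -> (psumA av j <= psumA av k)%N.
Proof.
move=> jk; rewrite /psumA [leqRHS](bigID (fun i : 'I_n => i < j)%N) /=.
rewrite [X in (_ <= X + _)%N](eq_bigl (fun i : 'I_n => i < j)%N) ?leq_addr // => i.
by case: (ltnP i j) => h; rewrite ?andbF // (leq_trans h jk).
Qed.

(** The search goes down from part i to the last s with psumA av s <= t, which steps over empty
    parts. *)
Lemma psumA_part i j t : (psumA av j <= t < psumA av i.+1)%N ->
  exists2 s : 'I_n, (j <= s <= i)%N & (psumA av s <= t < psumA av s.+1)%N.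
Proof.
move=> /andP[jt]; have := leqnn i; rewrite -ltnS.
elim: {1 3}i.+1 => [|k IH] ki tk; first by move: tk; rewrite psumA0.
have kn : (k < n)%N := leq_trans ki (ltn_ord i).
have [tk'|kt] := ltnP t (psumA av k); first exact: IH (ltnW ki) tk'.
exists (Ordinal kn); rewrite /= ?kt ?tk // andbC -ltnS ki /=.
by case: (leqP j k) => // /leq_psumA h; move: (leq_ltn_trans jt tk); rewrite ltnNge h.
Qed.

Definition occupied P (j : nat) : bool := [exists c in P, col c == j :> nat].

(** Each rook to the left removes the highest surviving part, so r rooks remove the r highest ones.
    As r <= i, one of the i + 1 parts always survives. *)
Lemma cancelledE P i k : (k <= i)%N -> cancelled P i k =
  [set s : 'I_n | (s <= i)%N && (i < s + \sum_(j < k) occupied P j)%N].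
Proof.
elim: k => [|k IH] ki.
  by apply/setP => s; rewrite !inE big_ord0 addn0 ltnNge andbN.
rewrite /= (IH (ltnW ki)) big_ord_recr /= -/(occupied P k) ki andbT.
set r := (\sum_(j < k) _)%N; have rk : (r <= k)%N.
  rewrite /r -[leqRHS]card_ord -sum1_card; apply: leq_sum => j _; exact: leq_b1.
case: (occupied P k); last by rewrite addn0.
apply/setP => s; rewrite !inE.
apply/idP/idP => [|h].
  case: (leqP s i) => si //=; case: (ltnP i (s + r)) => h /=; first by lia.
  move=> /forallP hs.
  (* Part i - r is the highest survivor, so maximality is tested against it. *)
  have im : (i - r < n)%N by apply: leq_ltn_trans (ltn_ord i); lia.
  by have := hs (Ordinal im); rewrite inE /=; lia.
case: (ltnP i (s + r)) => h1; first by apply/orP; left; lia.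
apply/orP; right; apply/and3P; split; [lia|lia|].
by apply/forallP => t; rewrite inE; apply/implyP; lia.
Qed.

Lemma occupied_setU1 c P j : occupied (c |: P) j = (col c == j :> nat) || occupied P j.
Proof.
apply/existsP/orP => [[d]|].
  rewrite !inE => /andP[/orP[/eqP->|dP] h]; first by left.
  by right; apply/existsP; exists d; rewrite dP.
case=> [h|/existsP[d /andP[dP h]]]; first by exists c; rewrite setU11.
by exists d; rewrite setU1r.
Qed.

Lemma cancelled_setU1 c P i k : (k <= i)%N -> (k <= col c)%N ->
  cancelled (c |: P) i k = cancelled P i k.
Proof.
move=> ki kc; rewrite !cancelledE //.
have -> // : (\sum_(j < k) occupied (c |: P) j = \sum_(j < k) occupied P j)%N.
apply: eq_bigr => j _; rewrite occupied_setU1 gtn_eqF //.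
exact: leq_trans (ltn_ord j) kc.
Qed.

(** Any number of rooks is allowed: these are the objects of the induction over columns. *)
Definition partial_placement (m : nat) P : bool :=
  [&& [forall c in P, col c < m]%N, one_per_column P & nonattacking P].

Definition uncancelled P c : bool :=
  [forall s, in_part c s ==> (s \notin cancelled P (col c) (col c))].

Lemma nonattackingP P : reflect {in P, forall c, uncancelled P c} (nonattacking P).
Proof. exact: (iffP forall_inP). Qed.

Lemma one_per_columnP P :
  reflect {in P &, forall c d, col c = col d -> c = d} (one_per_column P).
Proof.
apply: (iffP forall_inP) => [h c d cP dP e|h c cP].
  by move/forall_inP: (h c cP) => /(_ d dP); rewrite e eqxx => /eqP.
by apply/forall_inP => d dP; apply/implyP => /eqP e; apply/eqP; exact: h.
Qed.

Lemma card_partial_placement m P : partial_placement m P ->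
  #|P| = (\sum_(j < m) occupied P j)%N.
Proof.
case/and3P => /forall_inP cm /one_per_columnP opc _.
rewrite -sum1_card.
transitivity (\sum_(c in P) \sum_(j < m) (col c == j :> nat))%N.
  apply: eq_bigr => c cP; rewrite (bigD1 (Ordinal (cm c cP))) //= eqxx big1 // => j.
  by rewrite -val_eqE /= eq_sym => /negbTE ->.
rewrite exchange_big /=; apply: eq_bigr => j _.
case: (boolP (occupied P j)) => [/existsP[c /andP[cP /eqP cj]]|h].
  rewrite (bigD1 c) //= cj eqxx big1 // => d /andP[dP dc].
  case: eqP => // dj; case/eqP: dc; apply: opc => //.
  by apply/val_inj; rewrite /= dj cj.
rewrite big1 // => c cP; case: eqP => // cj; case/negP: h.
by apply/existsP; exists c; rewrite cP cj /=.
Qed.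

(** Cancellation depends only on rooks further left, so a rook added in column i disturbs none of
    those already placed. *)
Lemma partial_placement_setU1 i c P : col c = i ->
  partial_placement i.+1 (c |: P) && (c \notin P) =
  partial_placement i P && uncancelled P c.
Proof.
move=> ci; apply/idP/idP.
  case/andP => /and3P[/forall_inP cm /one_per_columnP opc /nonattackingP na] cP.
  have colP d : d \in P -> (col d < i)%N.
    move=> dP; have := cm d (setU1r c dP); rewrite ltnS leq_eqVlt => /orP[|//].
    move/eqP/val_inj => di; case/negP: cP.
    by rewrite -(opc d c) ?setU11 ?setU1r // di ci.
  apply/andP; split; last first.
    have := na c (setU11 _ _); rewrite /uncancelled.
    by rewrite cancelled_setU1.
  apply/and3P; split; first by apply/forall_inP.
    by apply/one_per_columnP => d d' dP d'P; apply: opc; exact: setU1r.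
  apply/nonattackingP => d dP; have := na d (setU1r c dP); rewrite /uncancelled.
  by rewrite cancelled_setU1 // ci ltnW // colP.
case/andP => /and3P[/forall_inP cm /one_per_columnP opc /nonattackingP na] unc.
have cP : c \notin P by apply/negP => /cm; rewrite ci ltnn.
rewrite cP andbT; apply/and3P; split.
- by apply/forall_inP => d /setU1P[->|/cm/ltnW //]; rewrite ci.
- apply/one_per_columnP => d d' /setU1P[->|dP] /setU1P[->|d'P] //.
  + by rewrite ci => e; have := cm d' d'P; rewrite -e ltnn.
  + by rewrite ci => e; have := cm d dP; rewrite e ltnn.
  + exact: opc.
- apply/nonattackingP => d /setU1P[->|dP]; rewrite /uncancelled.
    by rewrite cancelled_setU1.
  by rewrite cancelled_setU1 //; [exact: na|rewrite ci ltnW // cm].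
Qed.

(** Either column i is empty, or its unique rook can be removed, which leaves a placement in the
    earlier columns. *)
Lemma sum_partial_placementS (V : nmodType) (F : {set cell} -> V) i :
  \sum_(P | partial_placement i.+1 P) F P =
  \sum_(P | partial_placement i P)
    (F P + \sum_(c | (col c == i) && uncancelled P c) F (c |: P)).
Proof.
rewrite big_split /= (bigID (fun P => occupied P i)) /= addrC; congr (_ + _).
  apply: eq_bigl => P; apply/andP/idP => [[/and3P[/forall_inP cm opc na] h]|].
    apply/and3P; split=> //; apply/forall_inP => c cP.
    have := cm c cP; rewrite ltnS leq_eqVlt => /orP[ci|//].
    by case/negP: h; apply/existsP; exists c; rewrite cP.
  case/and3P => /forall_inP cm opc na; split.
    by apply/and3P; split=> //; apply/forall_inP => c /cm/ltnW.
  by apply/existsP => -[c /andP[/cm + /eqP ci]]; rewrite ci ltnn.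
(* The inner sum has one term when column i is occupied and none otherwise; it makes the rook
   available as a summation index. *)
transitivity (\sum_(P | partial_placement i.+1 P) \sum_(c in P | col c == i) F P).
  rewrite [RHS](bigID (fun P => occupied P i)) /= [X in _ = _ + X]big1 ?addr0.
    apply: eq_bigr => P /andP[/and3P[_ /one_per_columnP opc _]].
    case/existsP => c /andP[cP /eqP/val_inj ci].
    rewrite (big_pred1 c) // => d /=; apply/andP/eqP => [[dP /eqP di]|->].
      by apply: opc; rewrite ?di.
    by rewrite cP ci eqxx.
  move=> P /andP[_ h]; rewrite big_pred0 // => c; apply/negbTE/negP => /andP[cP ci].
  by case/negP: h; apply/existsP; exists c; rewrite cP; exact: ci.
rewrite (exchange_big_dep (fun c => col c == i)) /=; last by move=> P c _ /andP[].
rewrite [RHS](exchange_big_dep (fun c => col c == i)) /=; last by move=> P c _ /andP[].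
apply: eq_bigr => c /eqP ci.
rewrite (reindex_onto (fun P => c |: P) (fun P => P :\ c)) /=; last first.
  by move=> P /and3P[_ cP _]; rewrite finset.setD1K.
apply: eq_bigl => P; rewrite setU11 ci eqxx !andbT /=.
rewrite -(partial_placement_setU1 _ ci); congr (_ && _).
apply/eqP/idP => [<-|cP]; first by rewrite finset.setD11.
by rewrite finset.setU1K.
Qed.

(** With r rooks to the left, parts 0 to i - r survive; they are the lowest i - r + 1 parts, and
    [psumA] is indexed by the number of parts. *)
Lemma uncancelledE i c P : partial_placement i P -> col c = i -> (#|P| <= i)%N ->
  uncancelled P c = (row c < bv i + psumA av (i - #|P|).+1)%N.
Proof.
move=> pP ci rP; rewrite /uncancelled ci cancelledE // -(card_partial_placement pP).
move: (#|P|) rP => r rP; apply/forallP/idP => [h|h s].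
  rewrite ltnNge; apply/negP => le.
  have lt : (row c < bv i + psumA av i.+1)%N.
    by rewrite -ci; exact: (ltn_ord (tagged c)).
  have [s /andP[s1 s2] /andP[s3 s4]] :
      exists2 s : 'I_n, ((i - r).+1 <= s <= i)%N &
        (psumA av s <= row c - bv i < psumA av s.+1)%N.
    by apply: psumA_part; apply/andP; split; lia.
  have := h s; rewrite /in_part ci inE.
  rewrite s2 /= (_ : bv i + psumA av s <= row c)%N; last by lia.
  rewrite (_ : row c < bv i + psumA av s.+1)%N /=; last by lia.
  by lia.
apply/implyP; rewrite /in_part ci inE => /and3P[s1 s2 s3].
rewrite s1 /= -leqNgt.
have : (psumA av s < psumA av (i - r).+1)%N by lia.
by rewrite ltnNge => /negP h2; rewrite leqNgt; apply/negP => h3; apply: h2; apply: leq_psumA; lia.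
Qed.

End Board.

(** * Column sums of weights and the product formula *)

Section BoardWeights.
Variables (R : realType) (n : nat) (av bv : 'I_n -> nat) (sgn sgnb : 'I_n -> int).
Variables (a b q p : R[i]) (e : int -> R[i]) (X : R[i]).
Local Notation W := (ell_weight a b q p).
Local Notation cell := (Defs.cell av bv).
Local Notation col := (@Defs.col n av bv).
Local Notation row := (@Defs.row n av bv).
Local Notation weight := (cell_weight a b q p sgn sgnb).
Local Notation Abar := (spsumA av sgnb).
Hypothesis (sgnP : forall i, sgn i = 1 \/ sgn i = -1)
  (sgnbP : forall i, sgnb i = 1 \/ sgnb i = -1).
Hypotheses (eW : forall m, e (m + 1) - e m = W m) (e0 : e 0 = 0) (W0 : W 0 = 1).

Lemma spsumAS (i : 'I_n) : Abar i.+1 = Abar i + sgnb i * (av i)%:Z.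
Proof.
rewrite /spsumA (bigD1 i) //= addrC; congr (_ + _); apply: eq_bigl => j.
by rewrite ltnS ltn_neqAle andbC.
Qed.

Lemma spsumA0 : Abar 0 = 0.
Proof. by rewrite /spsumA big_pred0. Qed.

Lemma sum_weights_up (c : int) m : \sum_(0 <= t < m) W (c + t%:Z) = e (c + m%:Z) - e c.
Proof.
elim: m => [|m IH]; first by rewrite big_geq // addr0 subrr.
rewrite big_nat_recr //= IH -eW (_ : c + m.+1%:Z = c + m%:Z + 1); last by lia.
by rewrite addrC addrA subrK.
Qed.

Lemma sum_weights_down (c : int) m :
  \sum_(0 <= t < m) W (c - t.+1%:Z) = e c - e (c - m%:Z).
Proof.
elim: m => [|m IH]; first by rewrite big_geq // subr0 subrr.
rewrite big_nat_recr //= IH -eW (_ : c - m.+1%:Z + 1 = c - m%:Z); last by lia.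
by rewrite addrA subrK.
Qed.

(** [cell_weight] in terms of column and row numbers instead of the dependent type [cell], so that
    sums can run over intervals of rows. *)
Definition row_weight (i : 'I_n) (r : nat) : R[i] :=
  if [pick s : 'I_n | [&& (s <= i)%N, (bv i + psumA av s <= r)%N &
        (r < bv i + psumA av s.+1)%N]] is Some s
  then let t := (r - (bv i + psumA av s)).+1 in
    if sgnb s == 1 then - W (- Abar s - t%:Z) else W (- Abar s + t%:Z - 1)
  else if sgn i == 1 then W (- r.+1%:Z) else if r == 0%N then -1 else - W r%:Z.

Lemma sum_row_weight_base i :
  \sum_(0 <= r < bv i) row_weight i r = - e (- (sgn i * (bv i)%:Z)).
Proof.
have E r : (r < bv i)%N -> row_weight i r =
    if sgn i == 1 then W (0 - r.+1%:Z) else - W (0 + r%:Z).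
  move=> rb; rewrite /row_weight; case: pickP => [s /and3P[_ h _]|_]; first by lia.
  (* The exceptional weight -1 of the bottom cell is -W(0). *)
  by rewrite !add0r; case: ifP => // _; case: eqP => // ->; rewrite W0.
rewrite (eq_big_nat _ _ (fun r h => E r (proj2 (andP h)))).
case: (sgnP i) => -> /=.
  by rewrite sum_weights_down e0 mul1r !sub0r.
by rewrite sumrN sum_weights_up e0 subr0 add0r mulN1r opprK.
Qed.

Lemma sum_row_weight_part (i s : 'I_n) : (s <= i)%N ->
  \sum_(0 <= t < av s) row_weight i (bv i + psumA av s + t) =
  e (- Abar s.+1) - e (- Abar s).
Proof.
move=> si.
have E t : (t < av s)%N -> row_weight i (bv i + psumA av s + t) =
    if sgnb s == 1 then - W (- Abar s - t.+1%:Z) else W (- Abar s + t%:Z).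
  move=> ts; rewrite /row_weight; case: pickP => [s'|/(_ s)]; last first.
    by rewrite psumAS; lia.
  case/and3P => s'i h1 h2.
  (* Two different parts would contain the same row, against the monotonicity of the partial
     sums. *)
  have -> : s' = s.
    apply/val_inj/eqP; rewrite eqn_leq; apply/andP; split; rewrite leqNgt; apply/negP => h.
      by have := @leq_psumA n av s.+1 s' h; rewrite psumAS; lia.
    by have := @leq_psumA n av s'.+1 s h; lia.
  rewrite addKn; case: ifP => // _; congr W; lia.
rewrite (eq_big_nat _ _ (fun t h => E t (proj2 (andP h)))) spsumAS.
case: (sgnbP s) => -> /=.
  by rewrite sumrN sum_weights_down opprB mul1r opprD.
by rewrite sum_weights_up mulN1r opprD opprK.
Qed.

Lemma sum_row_weight (i : 'I_n) k : (k <= i.+1)%N ->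
  \sum_(0 <= r < bv i + psumA av k) row_weight i r =
  e (- Abar k) - e (- (sgn i * (bv i)%:Z)).
Proof.
elim: k => [|k IH] ki.
  by rewrite psumA0 addn0 sum_row_weight_base spsumA0 oppr0 e0 sub0r.
have kn : (k < n)%N := leq_trans ki (ltn_ord i).
pose s := Ordinal kn; have sE := @psumAS n av s.
rewrite sE addnA (@big_cat_nat _ _ _ (bv i + psumA av k)) ?leq_addr //= IH ?(ltnW ki) //.
have := big_addn 0 (bv i + psumA av k + av s) (bv i + psumA av k) xpredT (row_weight i).
rewrite add0n addKn => ->.
under eq_bigr do rewrite addnC.
rewrite (@sum_row_weight_part i s) //= addrC addrA; congr (_ - _).
by rewrite subrK.
Qed.

Lemma sum_uncancelled (i : 'I_n) (P : {set cell}) :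
  partial_placement i P -> (#|P| <= i)%N ->
  \sum_(c | (col c == i) && uncancelled P c) weight c =
  e (- Abar (i - #|P|).+1) - e (- (sgn i * (bv i)%:Z)).
Proof.
move=> pP rP; rewrite -sum_row_weight ?ltnS ?leq_subr //.
set h := (bv i + _)%N.
have hi : (h <= bv i + psumA av i.+1)%N.
  by rewrite leq_add2l leq_psumA // ltnS leq_subr.
rewrite big_mkord (big_ord_widen _ (row_weight i) hi).
transitivity (\sum_(c : cell | (col c == i) && (row c < h)%N) weight c).
  apply: eq_bigl => c; case: eqP => // ci; exact: uncancelledE.
transitivity (\sum_(j < n | j == i) \sum_(r < bv j + psumA av j.+1 | (r < h)%N) row_weight j r).
  by rewrite sig_big_dep.
by rewrite big_pred1_eq.
Qed.

(** The analogue of the falling factorial in the product formula of rook theory. *)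
Definition falling k : R[i] := \prod_(1 <= j < k.+1) (X - e (- Abar j)).

(** With r rooks in the first m columns, leaving column m empty contributes a factor X - e(-Abar(m -
    r + 1)) and filling it contributes e(-Abar(m - r + 1)) - e(-sgn b). Their sum X - e(-sgn b) no
    longer depends on the placement. *)
Lemma sum_partial_placement m : (m <= n)%N ->
  \sum_(P : {set cell} | partial_placement m P)
    (\prod_(c in P) weight c) * falling (m - #|P|) =
  \prod_(i < n | (i < m)%N) (X - e (- (sgn i * (bv i)%:Z))).
Proof.
elim: m => [|m IH] mn.
  rewrite [RHS]big_pred0 // (big_pred1 finset.set0) => [|P].
    by rewrite big_set0 /falling sub0n big_geq // mulr1.
  apply/idP/eqP => [/and3P[/forall_inP h _ _]|->].
    by apply/setP => c; rewrite inE; apply/negbTE/negP => /h.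
  apply/and3P; split; first by apply/forall_inP => c; rewrite inE.
    by apply/one_per_columnP => c d; rewrite inE.
  by apply/nonattackingP => c; rewrite inE.
pose i := Ordinal mn.
rewrite (@sum_partial_placementS n av bv _ _ i).
rewrite [RHS](bigD1 i) //= mulrC.
rewrite (eq_bigl (fun j : 'I_n => (j < m)%N)) => [|j]; last first.
  by rewrite ltnS ltn_neqAle andbC.
rewrite -IH ?(ltnW mn) // mulr_suml; apply: eq_bigr => P pP.
have rP : (#|P| <= m)%N.
  rewrite (card_partial_placement pP) -[leqRHS]card_ord -sum1_card.
  by apply: leq_sum => j _; exact: leq_b1.
have -> : \sum_(c | (col c == i) && uncancelled P c)
    (\prod_(d in c |: P) weight d) * falling (m.+1 - #|c |: P|)
  = (\sum_(c | (col c == i) && uncancelled P c) weight c) *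
    ((\prod_(c in P) weight c) * falling (m - #|P|)).
  rewrite mulr_suml; apply: eq_bigr => c /andP[/eqP ci unc].
  have : partial_placement i P && uncancelled P c by rewrite pP.
  rewrite -(partial_placement_setU1 _ ci) => /andP[_ cP].
  by rewrite big_setU1 //= cardsU1 cP add1n subSS mulrA.
rewrite sum_uncancelled // /= subSn // /falling big_nat_recr //=.
ring.
Qed.

Lemma sum_MR :
  \sum_(0 <= k < n.+1) MR av bv a b q p sgn sgnb (n - k) * falling k =
  \prod_(i < n) (X - e (- (sgn i * (bv i)%:Z))).
Proof.
rewrite [RHS](eq_bigl (fun i : 'I_n => (i < n)%N)) => [|i]; last by rewrite ltn_ord.
rewrite -sum_partial_placement // big_mkord.
rewrite /MR; under eq_bigr do rewrite mulr_suml.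
rewrite (exchange_big_dep (partial_placement n)) /=.
  apply: eq_bigr => P pP.
  (* A placement is counted only at the index k = n - #|P|. *)
  have kn : (n - #|P| < n.+1)%N by rewrite ltnS leq_subr.
  have rP : (#|P| <= n)%N.
    rewrite (card_partial_placement pP) -[leqRHS]card_ord -sum1_card.
    by apply: leq_sum => j _; exact: leq_b1.
  rewrite (big_pred1 (Ordinal kn)) // => k; case/and3P: pP => _ opc na.
  rewrite inE opc na andbT /= -val_eqE /=.
  by have := ltn_ord k; move: rP; move: (#|P|) => r; lia.
move=> k P _; rewrite inE => /and3P[_ opc na]; apply/and3P; split=> //.
by apply/forall_inP => c _; exact: ltn_ord.
Qed.

End BoardWeights.

Theorem theorem3p1 (R : realType) (n : nat) (av bv : 'I_n -> nat)
    (sgn sgnb : 'I_n -> int) (a b q p l z : R[i]) :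
  (1 <= n)%N ->
  (forall i, sgn i = 1 \/ sgn i = -1) ->
  (forall i, sgnb i = 1 \/ sgnb i = -1) ->
  a != 0 -> b != 0 -> q != 0 -> p != 0 -> `|p| < 1 ->
  cexp l = q ->
  let sb (i : 'I_n) : int := sgn i * (bv i)%:Z in
  let Abar (j : nat) : int := spsumA av sgnb j in
  (forall k : int, ell_weight_den a b q p k != 0) ->
  (forall i, ell_weight a b q p (- sb i) != 0) ->
  (forall i, ell_num_den (a * q ^ (- 2 * sb i)) (b * q ^ (- sb i)) q l p
               (z + (sb i)%:~R) != 0) ->
  (forall j : nat, (1 <= j <= n)%N ->
     ell_num_den (a * q ^ (- 2 * Abar j)) (b * q ^ (- Abar j)) q l p
       (z + (Abar j)%:~R) != 0) ->
  \prod_(i < n)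
    ell_num (a * q ^ (- 2 * sb i)) (b * q ^ (- sb i)) q l p (z + (sb i)%:~R)
  = \sum_(0 <= k < n.+1)
      rookR av bv a b q p sgn sgnb k *
      \prod_(1 <= j < k.+1)
        ell_num (a * q ^ (- 2 * Abar j)) (b * q ^ (- Abar j)) q l p
          (z + (Abar j)%:~R).
Proof.
move=> n1 sgnP sgnbP a0 b0 q0 p0 p1 lq sb Abar den0 W0 numsb numAbar.
(* G(m) is W(m) [z - m] with shifted parameters, and G(0) plays the role of X. *)
pose G := ell_shift a b q p l z; pose e (m : int) : R[i] := G 0 - G m.
(* n >= 1 supplies a column, whose elliptic number gives the nonvanishing needed for the telescoping
   relation. *)
have [q1 bx1 ax1 _] := ell_weight_ell_num b0 q0 lq den0 (numsb (Ordinal n1)).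
have eW m : e (m + 1) - e m = ell_weight a b q p m.
  rewrite -[RHS]opprK -(ell_shiftS a0 b0 q0 p0 p1 den0 m q1 bx1 ax1) /e -/G.
  by move: (G 0) (G m) (G (m + 1)) => u v w; rewrite !opprB addrC addrA subrK.
have e0 : e 0 = 0 by rewrite /e subrr.
(* Thus X - e(-k) is W(-k) times the elliptic number of z + k. *)
have eG k : G 0 - e (- k) = G (- k) by rewrite /e opprB addrC subrK.
have := @sum_MR R n av bv sgn sgnb a b q p e (G 0) sgnP sgnbP eW e0 (ell_weight0 den0).
rewrite (_ : \prod_(i < n) (G 0 - e (- (sgn i * (bv i)%:Z))) =
  (\prod_(i < n) ell_weight a b q p (- sb i)) * \prod_(i < n)
    ell_num (a * q ^ (- 2 * sb i)) (b * q ^ (- sb i)) q l p (z + (sb i)%:~R)); last first.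
  rewrite -big_split /=; apply: eq_bigr => i _; rewrite eG.
  by have [_ _ _ ->] := ell_weight_ell_num b0 q0 lq den0 (numsb i).
have Wprod0 : \prod_(i < n) ell_weight a b q p (- sb i) != 0.
  by apply/prodf_neq0 => i _; exact: W0.
(* The product of the W(-sb i) is the denominator in [rookR]; the weights split off [falling] are
   its numerator. *)
move=> h; apply: (mulfI Wprod0); rewrite -h mulr_sumr; apply: eq_big_nat => k /andP[_ kn].
rewrite /rookR -/Abar (_ : falling _ _ _ _ _ =
  (\prod_(1 <= s < k.+1) ell_weight a b q p (- Abar s)) * \prod_(1 <= j < k.+1)
    ell_num (a * q ^ (- 2 * Abar j)) (b * q ^ (- Abar j)) q l p (z + (Abar j)%:~R)); last first.
  rewrite -big_split /=; apply: eq_big_nat => j /andP[j1 jk]; rewrite eG.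
  have jn : (1 <= j <= n)%N by rewrite j1 -ltnS (leq_trans jk).
  by have [_ _ _ ->] := ell_weight_ell_num b0 q0 lq den0 (numAbar j jn).
move: (\prod_(1 <= s < k.+1) _) (\prod_(1 <= j < k.+1) _) (MR _ _ _ _ _ _ _ _ _).
move: Wprod0; rewrite /sb; move: (\prod_(i < n) _) => w w0 s t u.
by field.
Qed.
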